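(* Let $k$ be a positive integer. There is an algorithm that, given a graph $G$ on $n$ vertices with $\Delta_G\le k\cdot(\log_2 n)^{1/3}$, computes the vector space $WCW(G)$ in $O(n^{3+2k^2+2k^3})$ time.
   Context: All graphs are finite, simple, undirected; $n=|V(G)|$ and $\Delta_G=\max\{|N(v)|:v\in V(G)\}$. For $w:V(G)\to\mathbb{R}$ and $S\subseteq V(G)$ let $w(S)=\sum_{s\in S}w(s)$; $G$ is $w$-well-covered if all maximal independent sets of $G$ have the same weight, and $WCW(G)$ is the vector space of all weight functions $w$ for which $G$ is $w$-well-covered (computing it means producing a system of linear equations whose solution space is $WCW(G)$). *)

(* Defs.v *)
From mathcomp Require Import all_boot all_order all_algebra.
From mathcomp Require Import reals exp.

Set Implicit Arguments.
Unset Strict Implicit.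
Unset Printing Implicit Defensive.

Import Order.TTheory GRing.Theory Num.Theory.

Local Open Scope ring_scope.

Record sgraph (V : finType) := SGraph {
  adj :> rel V;
  adj_sym : symmetric adj;
  adj_irr : irreflexive adj
}.

Section Graphs.
Variables (V : finType) (G : sgraph V).

Definition neighbors (v : V) : {set V} := [set u | G v u].

Definition max_degree : nat := \max_(v : V) #|neighbors v|.

Definition independent (S : {set V}) : bool :=
  [forall u in S, forall v in S, ~~ G u v].

Definition max_independent (S : {set V}) : bool := maxset independent S.

Definition weight (R : realType) (w : {ffun V -> R}) (S : {set V}) : R :=
  \sum_(s in S) w s.

Definition well_covered (R : realType) (w : {ffun V -> R}) : bool :=
  [forall S, forall T,
     max_independent S ==> max_independent T ==> (weight w S == weight w T)].

Definition WCW (R : realType) : {pred {ffun V -> R}} :=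
  [pred w | well_covered w].
Arguments WCW : clear implicits.

Fact WCW_submod_closed (R : realType) :
  submod_closed (WCW R : {pred {ffun V -> R^o}}).
Proof.
split=> [|a u v].
  rewrite inE; apply/forallP=> S; apply/forallP=> T; do 2!apply/implyP=> _.
  by rewrite /weight !big1 // => s _; rewrite ffunE.
rewrite !inE => /forallP uP /forallP vP.
apply/forallP=> S; apply/forallP=> T; apply/implyP=> mS; apply/implyP=> mT.
have wE (X : {set V}) :
    weight (a *: u + v) X = a * weight u X + weight v X.
  rewrite /weight mulr_sumr -big_split /=; apply: eq_bigr => s _.
  by rewrite !ffunE.
move: (uP S) (vP S) => /forallP/(_ T) + /forallP/(_ T).
by rewrite !wE mS mT /= => /eqP-> /eqP->.
Qed.

End Graphs.

Arguments WCW {V} G R.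

(* Running times refer to a unit-cost word RAM: registers and a random-access
   memory, both indexed by nat and holding natural numbers.  A computed value
   must be at most the word bound W; taking W polynomial in n gives words of
   O(log n) bits.  A run that would overflow has no execution.
   Subtraction is truncated at 0, and division by 0 gives 0. *)
Inductive binop := Add | Sub | Mul | Div.

Definition eval_binop (o : binop) : nat -> nat -> nat :=
  match o with Add => addn | Sub => subn | Mul => muln | Div => divn end.

Inductive program :=
  | Skip
  | Imm (r c : nat)                   (* r := c *)
  | Bin (o : binop) (r a b : nat)     (* r := a o b *)
  | Read (r a : nat)                  (* r := memory[a] *)
  | Write (a b : nat)                 (* memory[a] := b *)
  | Seq (p q : program)
  | If (r : nat) (p q : program)      (* branches on r <> 0 *)
  | While (r : nat) (p : program).    (* loops as long as r <> 0 *)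

Record state := State { reg : nat -> nat; mem : nat -> nat }.

Definition set_reg (s : state) (r x : nat) : state :=
  State [eta reg s with r |-> x] (mem s).

Definition set_mem (s : state) (a x : nat) : state :=
  State (reg s) [eta mem s with a |-> x].

(* [exec W p s t s']: with word bound W, p started in s halts in s' after
   exactly t unit-cost steps (instructions and evaluated branch conditions). *)
Inductive exec (W : nat) : program -> state -> nat -> state -> Prop :=
  | ExecSkip s : exec W Skip s 1 s
  | ExecImm r c s : (c <= W)%N -> exec W (Imm r c) s 1 (set_reg s r c)
  | ExecBin o r a b s :
      (eval_binop o (reg s a) (reg s b) <= W)%N ->
      exec W (Bin o r a b) s 1
        (set_reg s r (eval_binop o (reg s a) (reg s b)))
  | ExecRead r a s : exec W (Read r a) s 1 (set_reg s r (mem s (reg s a)))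
  | ExecWrite a b s : exec W (Write a b) s 1 (set_mem s (reg s a) (reg s b))
  | ExecSeq p q s t s1 u s2 :
      exec W p s t s1 -> exec W q s1 u s2 -> exec W (Seq p q) s (t + u) s2
  | ExecIfT r p q s t s1 :
      reg s r != 0%N -> exec W p s t s1 -> exec W (If r p q) s t.+1 s1
  | ExecIfF r p q s t s1 :
      reg s r == 0%N -> exec W q s t s1 -> exec W (If r p q) s t.+1 s1
  | ExecWhileT r p s t s1 u s2 :
      reg s r != 0%N -> exec W p s t s1 -> exec W (While r p) s1 u s2 ->
      exec W (While r p) s (t + u).+1 s2
  | ExecWhileF r p s : reg s r == 0%N -> exec W (While r p) s 1 s.

(* A graph on 'I_n is input as n in register 0 and its adjacency matrix,
   row by row, in memory cells 0, ..., n * n - 1; everything else is 0. *)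
Definition adj_cell (n : nat) (G : sgraph 'I_n) (a : nat) : nat :=
  [exists i : 'I_n, exists j : 'I_n, (a == i * n + j)%N && G i j].

Definition input_state (n : nat) (G : sgraph 'I_n) : state :=
  State [eta (fun=> 0%N) with 0%N |-> n] (adj_cell G).

(* A system of linear equations is output as its number m of equations in
   register 0 and an address in register 1 from which memory contains
   A_0, B_0, ..., A_(m-1), B_(m-1), where the i-th equation is
   \sum_j A_i j * w j = \sum_j B_i j * w j; having two sides makes up for the
   absence of negative words. *)
Definition output_lhs (n : nat) (s : state) : 'M[nat]_(reg s 0, n) :=
  \matrix_(i, j) mem s (reg s 1 + i.*2 * n + j)%N.

Definition output_rhs (n : nat) (s : state) : 'M[nat]_(reg s 0, n) :=
  \matrix_(i, j) mem s (reg s 1 + i.*2.+1 * n + j)%N.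

Definition output_solutions (R : realType) (n : nat) (s : state) :
    {pred {ffun 'I_n -> R}} :=
  [pred w : {ffun 'I_n -> R} | [forall i,
     \sum_j (output_lhs n s i j)%:R * w j ==
     \sum_j (output_rhs n s i j)%:R * w j]].
Arguments output_solutions R {n} s.

Definition log2 (R : realType) (x : R) : R := ln x / ln 2.

(* Main.v *)
Require Import Defs.
From mathcomp Require Import all_boot all_order all_algebra.
From mathcomp Require Import reals exp.
From mathcomp Require Import zify.
(* [Defs.mem] is shadowed by [ssrbool.mem]. *)
Import Defs.

(* Let S and T be two maximal independent sets with different weights and the
   largest possible intersection.  Then S \ T and T \ S are completely joined,
   for otherwise a maximal independent set containing S /\ T and two nonadjacent
   vertices s of S \ T and t of T \ S has the same weight as both.  Removing
   from such S and T all common vertices not within distance two of S \ T or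
   T \ S leaves independent sets with the same closed neighbourhood, and any two
   such sets have equal weight for every w in WCW, since they can be completed
   by the same vertices.  So WCW is cut out by the equations w(S) = w(T) for
   local pairs of independent sets with equal closed neighbourhoods.

   A local pair is described by an edge x y and by the choice of subsets of the
   vertices adjacent to x or y, of which there are at most 2D, and of the
   vertices reached from x or y by a walk of length 3, at most 2D^3 of them.
   Hence all local pairs are among n^2 2^(2D^3 + 4D) = O(n^(3 + 2k^3)) codes, and
   one loop over the codes tests each of them in time O(n^2). *)

Set Implicit Arguments.
Unset Strict Implicit.
Unset Printing Implicit Defensive.

(** * Compiling expressions and reasoning about running times *)

Inductive expr :=
  | Var (r : nat)
  | Cst (c : nat)
  | Op (o : binop) (a b : expr)
  | Fetch (a : expr).

Fixpoint eval (s : state) (e : expr) : nat :=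
  match e with
  | Var r => reg s r
  | Cst c => c
  | Op o a b => eval_binop o (eval s a) (eval s b)
  | Fetch a => mem s (eval s a)
  end.

(* [compile r t e] leaves the value of [e] in register [r], using the registers
   from [t] on as a stack of temporaries. *)
Fixpoint compile (r t : nat) (e : expr) : program :=
  match e with
  | Var x => Seq (Imm t 0) (Bin Add r x t)
  | Cst c => Imm r c
  | Op o a b => Seq (compile t t.+1 a) (Seq (compile t.+1 t.+2 b) (Bin o r t t.+1))
  | Fetch a => Seq (compile t t.+1 a) (Read r t)
  end.

Fixpoint cost (e : expr) : nat :=
  match e with
  | Var _ => 2
  | Cst _ => 1
  | Op _ a b => cost a + (cost b + 1)
  | Fetch a => cost a + 1
  end.

Fixpoint below (K : nat) (e : expr) : bool :=
  match e with
  | Var r => r < K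
  | Cst _ => true
  | Op _ a b => below K a && below K b
  | Fetch a => below K a
  end.

(* If the leaves of [e] are at most [B >= 2], then all intermediate values are
   at most [B ^ esize e]. *)
Fixpoint esize (e : expr) : nat :=
  match e with
  | Var _ => 1
  | Cst c => c.+1
  | Op _ a b => esize a + esize b
  | Fetch a => (esize a).+1
  end.

Lemma esize_gt0 e : 0 < esize e.
Proof. by elim: e => //= o a ha b _; rewrite addn_gt0 ha. Qed.

Lemma eval_ext K s s' e :
  below K e -> (forall r, r < K -> reg s r = reg s' r) -> mem s =1 mem s' ->
  eval s e = eval s' e.
Proof.
move=> + hr hm; elim: e => [r|c|o a iha b ihb|a ih] //=.
- exact: hr.
- by case/andP=> /iha-> /ihb->.
- by move=> /ih->.
Qed.

Lemma eval_le B K s e :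
  1 < B -> below K e -> (forall r, r < K -> reg s r <= B) ->
  (forall x, mem s x <= B) -> eval s e <= B ^ esize e.
Proof.
move=> hB + hr hm; elim: e => [r|c|o a iha b ihb|a _] /=.
- by rewrite expn1; apply: hr.
- move=> _; have h := ltn_expl c hB.
  by apply: leq_trans (ltnW h) _; rewrite leq_exp2l.
- move=> /andP[/iha ha /ihb hb].
  (* Both bounds are at least 2, so their sum is at most their product; adding exponents thus covers
     addition as well as multiplication. *)
  have ga : 1 < B ^ esize a by rewrite -(exp1n (esize a)) ltn_exp2r ?esize_gt0.
  have gb : 1 < B ^ esize b by rewrite -(exp1n (esize b)) ltn_exp2r ?esize_gt0.
  rewrite expnD; case: o => /=; [nia|nia|exact: leq_mul|].
  apply: leq_trans (leq_div _ _) _; nia.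
- move=> _; apply: leq_trans (hm _) _.
  by rewrite -{1}(expn1 B) leq_exp2l.
Qed.

Lemma set_reg_eq s r x : reg (set_reg s r x) r = x.
Proof. by rewrite /= eqxx. Qed.

Lemma set_reg_neq s r x y : y != r -> reg (set_reg s r x) y = reg s y.
Proof. by move=> /= /negbTE->. Qed.

(** The frame clause carries the induction: the left operand, kept in [t], survives the evaluation
    of the right one, which only touches registers from [t.+1] on. *)
Lemma exec_compile W B K e r t s :
    1 < B -> B ^ esize e <= W -> r < t -> K <= t -> below K e ->
    (forall x, x < K -> reg s x <= B) -> (forall x, mem s x <= B) ->
  exists s', [/\ exec W (compile r t e) s (cost e) s',
    reg s' r = eval s e,
    forall x, x < t -> x != r -> reg s' x = reg s x
    & mem s' = mem s].
Proof.
move=> hB; elim: e r t s => [x|c|o a iha b ihb|a ih] r t s /= hW rt Kt.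
- move=> xK hr hm; exists (set_reg (set_reg s t 0) r (reg s x)).
  have xt : x != t by rewrite neq_ltn (leq_trans xK).
  split=> //; last 1 first.
  + by move=> y yt yr; rewrite !set_reg_neq // neq_ltn yt.
  + rewrite -[2]/(1 + 1); apply: ExecSeq; first exact: ExecImm.
    have := @ExecBin W Add r x t (set_reg s t 0).
    rewrite [eval_binop _ _ _]/= !eqxx (negbTE xt) addn0; apply.
    by apply: leq_trans (hr _ xK) _; rewrite expn1 in hW.
  + by rewrite set_reg_eq.
- move=> _ hr hm; exists (set_reg s r c); split=> //.
  + apply: ExecImm; apply: leq_trans _ hW.
    have h := ltn_expl c hB.
    by apply: leq_trans (ltnW h) _; rewrite leq_exp2l.
  + by rewrite set_reg_eq.
  + by move=> y _ yr; rewrite set_reg_neq.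
- move=> /andP[ba bb] hr hm.
  have eval_W := eval_le hB (_ : below K (Op o a b)) hr hm.
  rewrite /= ba bb in eval_W; move: (eval_W isT) => {}eval_W.
  have hWa : B ^ esize a <= W.
    by apply: leq_trans _ hW; rewrite leq_exp2l // leq_addr.
  have hWb : B ^ esize b <= W.
    by apply: leq_trans _ hW; rewrite leq_exp2l // leq_addl.
  have [s1 [x1 r1 f1 m1]] := iha t t.+1 s hWa (ltnSn t) (leqW Kt) ba hr hm.
  have g1 x : x < K -> reg s1 x = reg s x.
    by move=> xK; apply: f1; [exact: (leq_trans xK (leqW Kt)) |
                              rewrite neq_ltn (leq_trans xK Kt)].
  have [|x|s2 [x2 r2 f2 m2]] :=
      ihb t.+1 t.+2 s1 hWb (ltnSn _) (leqW (leqW Kt)) bb.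
  + by move=> x xK; rewrite g1 // hr.
  + by rewrite m1.
  have r2' : reg s2 t = eval s a.
    by rewrite f2 ?r1 // neq_ltn ltnSn.
  have r2'' : reg s2 t.+1 = eval s b.
    by rewrite r2; apply: eval_ext bb g1 _; rewrite m1.
  exists (set_reg s2 r (eval_binop o (eval s a) (eval s b))); split.
  + apply: ExecSeq x1 _; apply: ExecSeq x2 _.
    rewrite -r2' -r2''; apply: ExecBin; rewrite r2' r2''.
    exact: leq_trans eval_W hW.
  + by rewrite set_reg_eq.
  + move=> x xt xr; rewrite set_reg_neq // f2 ?f1 //; try lia.
  + by rewrite /= m2.
- move=> ba hr hm.
  have hWa : B ^ esize a <= W by apply: leq_trans _ hW; rewrite leq_exp2l.
  have [s1 [x1 r1 f1 m1]] := ih t t.+1 s hWa (ltnSn t) (leqW Kt) ba hr hm.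
  exists (set_reg s1 r (mem s (eval s a))); split.
  + apply: ExecSeq x1 _; rewrite -r1 -m1; exact: ExecRead.
  + by rewrite set_reg_eq.
  + by move=> x xt xr; rewrite set_reg_neq // f1 //; lia.
  + by [].
Qed.

Definition upd (m : nat -> nat) (b len : nat) (f : nat -> nat) : nat -> nat :=
  fun x => if b <= x < b + len then f (x - b) else m x.

Lemma upd_get m b len f x : x < len -> upd m b len f (b + x) = f x.
Proof. by rewrite /upd leq_addr ltn_add2l addKn => ->. Qed.

Lemma upd_skip m b len f x : (x < b) || (b + len <= x) -> upd m b len f x = m x.
Proof. by rewrite /upd => h; case: ifP => //; lia. Qed.

Lemma upd_step m b j f x :
  [eta upd m b j f with b + j |-> f j] x = upd m b j.+1 f x.
Proof.
rewrite /= /upd; case: eqP => [->|nx]; first by rewrite leq_addr ltn_add2l ltnSn addKn.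
by congr (if _ then _ else _); lia.
Qed.

(** * Hoare triples with time bounds *)

Section Triples.

Variables W B : nat.
Hypothesis B_gt1 : 1 < B.

(** A Hoare triple for total correctness, with running time at most [T]. *)
Definition triple (A : state -> Prop) (p : program) (T : nat)
    (A' : state -> Prop) : Prop :=
  forall s, A s -> exists t s', [/\ exec W p s t s', t <= T & A' s'].

(* Only the registers below [K] and the memory cells in [P] are live. *)
Definition agrees (K : nat) (P : pred nat) (s s1 : state) : Prop :=
  [/\ forall r, r < K -> reg s1 r = reg s r,
      forall x, P x -> mem s1 x = mem s x,
      forall r, r < K -> reg s1 r <= B
    & forall x, mem s1 x <= B].

Lemma triple_seq A p T A' q T' A'' :
  triple A p T A' -> triple A' q T' A'' -> triple A (Seq p q) (T + T') A''.
Proof.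
move=> hp hq s /hp[t [s1 [x1 t1 /hq[u [s2 [x2 t2 a2]]]]]].
by exists (t + u), s2; split=> //; [exact: ExecSeq x1 x2 | exact: leq_add].
Qed.

Lemma triple_conseq A p T A' A1 T1 A1' :
  triple A p T A' -> (forall s, A1 s -> A s) -> T <= T1 ->
  (forall s, A' s -> A1' s) -> triple A1 p T1 A1'.
Proof.
move=> hp h1 hT h2 s /h1/hp[t [s1 [x1 t1 /h2 a]]].
by exists t, s1; split=> //; exact: leq_trans t1 hT.
Qed.

Lemma triple_time A p T T1 A' :
  triple A p T A' -> T <= T1 -> triple A p T1 A'.
Proof. by move=> hp hT; apply: triple_conseq hp _ hT _. Qed.

Lemma agrees_weaken K K' (P P' : pred nat) s s' s1 :
  agrees K P s s1 -> K' <= K -> (forall x, P' x -> P x) ->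
  (forall r, r < K' -> reg s r = reg s' r) ->
  (forall x, P' x -> mem s x = mem s' x) -> agrees K' P' s' s1.
Proof.
move=> [h1 h2 h3 h4] hK hP hr hm; split=> //.
- by move=> r rK; rewrite h1 ?hr // (leq_trans rK).
- by move=> x xP; rewrite h2 ?hm // hP.
- by move=> r rK; apply: h3; apply: leq_trans rK hK.
Qed.

(** Cells outside [P] may hold anything, so every full memory extending the known part is
    considered. This lets an iteration start with the leftovers of the previous one in its scratch
    arrays. *)
Lemma triple_havoc K (P : pred nat) s p T A :
  (forall m, (forall x, P x -> m x = mem s x) ->
    triple (agrees K predT (State (reg s) m)) p T A) ->
  triple (agrees K P s) p T A.
Proof.
move=> h s1 [h1 h2 h3 h4].
by apply: (h (mem s1)).
Qed.

(** [maxn K r.+1] covers both uses: overwriting a live register, and making register [K] live. *)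
Lemma triple_assign K r e s :
  B ^ esize e <= W -> r <= K -> below K e -> eval s e <= B ->
  triple (agrees K predT s) (compile r K.+1 e) (cost e)
    (agrees (maxn K r.+1) predT (set_reg s r (eval s e))).
Proof.
move=> hW rK bK he s1 [h1 h2 h3 h4].
have ev : eval s1 e = eval s e.
  by apply: eval_ext bK h1 _ => x; apply: h2.
have [s' [x' r' f' m']] := exec_compile B_gt1 hW (rK : r < K.+1) (leqnSn K) bK h3 h4.
exists (cost e), s'; split=> //; split.
- move=> x xK; have [->|nx] := eqVneq x r; first by rewrite r' set_reg_eq.
  have {}xK : x < K by move: xK; rewrite leq_max; lia.
  by rewrite f' ?set_reg_neq ?h1 // ltnW.
- by move=> x _; rewrite m' h2.
- move=> x xK; have [->|nx] := eqVneq x r; first by rewrite r' ev.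
  have {}xK : x < K by move: xK; rewrite leq_max; lia.
  by rewrite f' ?h3 // ltnW.
- by rewrite m'.
Qed.

Definition store (K : nat) (a e : expr) : program :=
  Seq (compile K K.+1 a) (Seq (compile K.+1 K.+2 e) (Write K K.+1)).

Lemma triple_store K a e s :
  B ^ esize a <= W -> B ^ esize e <= W -> below K a -> below K e ->
  eval s e <= B ->
  triple (agrees K predT s) (store K a e) (cost a + (cost e + 1))
    (agrees K predT (set_mem s (eval s a) (eval s e))).
Proof.
move=> hWa hWe ba be he s1 [h1 h2 h3 h4].
have ev e' : below K e' -> eval s1 e' = eval s e'.
  by move=> b; apply: eval_ext b h1 _ => x; apply: h2.
have [s2 [x2 r2 f2 m2]] := exec_compile B_gt1 hWa (ltnSn K) (leqnSn K) ba h3 h4.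
have g2 x : x < K -> reg s2 x = reg s1 x by move=> xK; apply: f2; lia.
have [| |s3 [x3 r3 f3 m3]] :=
    exec_compile (s := s2) B_gt1 hWe (ltnSn K.+1) (leqW (leqnSn K)) be.
- by move=> x xK; rewrite g2 ?h3.
- by rewrite m2.
have r3a : reg s3 K = eval s a by rewrite f3 ?r2 ?ev //; lia.
have r3e : reg s3 K.+1 = eval s e.
  by rewrite r3 -(ev e) //; apply: eval_ext be g2 _; rewrite m2.
exists (cost a + (cost e + 1)), (set_mem s3 (eval s a) (eval s e)); split=> //.
  apply: ExecSeq x2 _; apply: ExecSeq x3 _; rewrite -r3a -r3e; exact: ExecWrite.
have g3 x : x < K -> reg s3 x = reg s1 x by move=> xK; rewrite f3 ?g2 //; lia.
split=> [x xK|x _|x xK|x] /=; rewrite ?g3 ?h1 -?h1 ?h3 //.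
- by case: eqP => //; rewrite m3 m2 h2.
- by case: eqP => //; rewrite m3 m2.
Qed.

(* The index lives in register [K] and is live only in the body. *)
Definition loop (K l : nat) (body : program) : program :=
  Seq (Imm K 0) (Seq (Bin Sub K.+1 l K)
    (While K.+1 (Seq body (Seq (Imm K.+1 1)
      (Seq (Bin Add K K K.+1) (Bin Sub K.+1 l K)))))).

(** [f j] is the abstract state before iteration [j]. Besides the body, an iteration costs 4 steps:
    the test and three instructions updating index and counter. *)
Lemma triple_loop K l P body T (f : nat -> state) N :
  N <= B -> B <= W -> l < K ->
  (forall j, j <= N -> reg (f j) l = N) ->
  (forall j, j < N ->
    triple (agrees K.+1 P (set_reg (f j) K j)) body T
      (agrees K.+1 P (set_reg (f j.+1) K j))) ->
  triple (agrees K P (f 0)) (loop K l body) (N * (T + 4) + 3)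
    (agrees K P (f N)).
Proof.
move=> hN hW lK hl hbody s [h1 h2 h3 h4].
have lW : N <= W := leq_trans hN hW.
(* Induction on the number [j] of remaining iterations, which register [K.+1] holds. *)
have run j s1 : j <= N ->
    agrees K.+1 P (set_reg (f (N - j)) K (N - j)) s1 -> reg s1 K.+1 = j ->
    exists t s', [/\ exec W (While K.+1 (Seq body (Seq (Imm K.+1 1)
      (Seq (Bin Add K K K.+1) (Bin Sub K.+1 l K))))) s1 t s',
      t <= j * (T + 4) + 1 & agrees K P (f N) s'].
  elim: j s1 => [|j ih] s1 jN.
    rewrite subn0 => ag r0; exists 1, s1; split=> //.
      by apply: ExecWhileF; rewrite r0.
    apply: agrees_weaken ag _ _ _ _ => // x xK.
    by rewrite set_reg_neq //; lia.
  have lt : N - j.+1 < N by lia.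
  move=> /(hbody _ lt)[t [s2 [x2 t2 [g1 g2 g3 g4]]]] r1.
  have e1 : (N - j.+1).+1 = N - j by lia.
  have r2K : reg s2 K = N - j.+1 by rewrite g1 // set_reg_eq.
  have r2l : reg s2 l = N by rewrite g1 ?set_reg_neq ?hl //; lia.
  set s3 := set_reg s2 K.+1 1; set s4 := set_reg s3 K (N - j).
  set s5 := set_reg s4 K.+1 j.
  have x3 : exec W (Imm K.+1 1) s2 1 s3 by apply: ExecImm; lia.
  have x4 : exec W (Bin Add K K K.+1) s3 1 s4.
    rewrite /s4; have -> : N - j = eval_binop Add (reg s3 K) (reg s3 K.+1).
      by rewrite /s3 set_reg_eq set_reg_neq ?r2K /=; lia.
    apply: ExecBin; rewrite /s3 set_reg_eq set_reg_neq ?r2K /=; lia.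
  have x5 : exec W (Bin Sub K.+1 l K) s4 1 s5.
    have r4 : reg s4 l = N by rewrite /s4 /s3 !set_reg_neq //; lia.
    rewrite /s5; have -> : j = eval_binop Sub (reg s4 l) (reg s4 K).
      by rewrite r4 /s4 set_reg_eq /=; lia.
    apply: ExecBin; rewrite r4 /s4 set_reg_eq /=; lia.
  have [| |t6 [s6 [x6 t6T ag6]]] := ih s5 (ltnW jN).
  - split=> //.
    + move=> x xK; have nK : x != K.+1 by lia.
      rewrite /s5 set_reg_neq //.
      rewrite /s4 /s3; have [->|nx] := eqVneq x K; first by rewrite !set_reg_eq.
      by rewrite !set_reg_neq // g1 // set_reg_neq // e1.
    + by move=> x xP; rewrite /= g2 //= -e1.
    + move=> x xK; have nK : x != K.+1 by lia.
      rewrite /s5 set_reg_neq //.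
      rewrite /s4 /s3; have [->|nx] := eqVneq x K; first by rewrite set_reg_eq; lia.
      by rewrite !set_reg_neq // g3.
  - by rewrite /s5 set_reg_eq.
  exists (t + (1 + (1 + 1)) + t6).+1, s6; split=> //; last by lia.
  apply: ExecWhileT x6; first by rewrite r1.
  by apply: ExecSeq x2 _; apply: ExecSeq x3 _; apply: ExecSeq x4 x5.
set s1 := set_reg s K 0; set s2 := set_reg s1 K.+1 N.
have x1 : exec W (Imm K 0) s 1 s1 by apply: ExecImm.
have r1 : reg s1 l = N by rewrite /s1 set_reg_neq ?h1 ?hl //; lia.
have x2 : exec W (Bin Sub K.+1 l K) s1 1 s2.
  rewrite /s2; have -> : N = eval_binop Sub (reg s1 l) (reg s1 K).
    by rewrite r1 /s1 set_reg_eq /= subn0.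
  by apply: ExecBin; rewrite r1 /s1 set_reg_eq /= subn0.
have [| |t3 [s3 [x3 t3T ag3]]] := run N s2 (leqnn N).
- rewrite subnn; split=> //.
  + move=> x xK; have nK : x != K.+1 by lia.
    rewrite /s2 set_reg_neq // /s1.
    have [->|nx] := eqVneq x K; first by rewrite !set_reg_eq.
    by rewrite !set_reg_neq // h1 //; lia.
  + move=> x xK; have nK : x != K.+1 by lia.
    rewrite /s2 set_reg_neq // /s1.
    have [->|nx] := eqVneq x K; first by rewrite !set_reg_eq.
    by rewrite !set_reg_neq // h3 //; lia.
- by rewrite /s2 set_reg_eq.
exists (1 + (1 + t3)), s3; split=> //; last by lia.
by apply: ExecSeq x1 _; apply: ExecSeq x2 x3.
Qed.

Definition sum (K l : nat) (e : expr) : program :=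
  Seq (Imm K 0) (loop K.+1 l (compile K K.+3 (Op Add (Var K) e))).

(** Register [K] accumulates and [K.+1] is the index; quantifying over the content [x] of [K] forces
    the summands not to depend on the partial sum. *)
Lemma triple_sum K l e s N (g : nat -> nat) :
  N <= B -> B ^ (esize e).+1 <= W -> l < K -> below K.+2 e ->
  reg s l = N ->
  (forall j x, j < N -> eval (set_reg (set_reg s K x) K.+1 j) e = g j) ->
  \sum_(j < N) g j <= B ->
  triple (agrees K predT s) (sum K l e) (N * (cost e + 7) + 4)
    (agrees K.+1 predT (set_reg s K (\sum_(j < N) g j))).
Proof.
move=> hN hW lK be rl he hS.
have BW : B <= W.
  by apply: leq_trans _ hW; rewrite -{1}(expn1 B) leq_exp2l.
pose f j := set_reg s K (\sum_(i < j) g i).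
apply: (@triple_time _ _ (1 + (N * (cost e + 3 + 4) + 3))); last by lia.
apply: triple_seq (_ : triple _ _ _ (agrees K.+1 predT (f 0))) _.
  move=> s1 [h1 h2 h3 h4]; exists 1, (set_reg s1 K 0); split=> //.
    exact: ExecImm.
  split=> // x xK; have [->|nx] := eqVneq x K; rewrite ?set_reg_eq ?big_ord0 //.
    by rewrite !set_reg_neq // h1 //; lia.
  by rewrite set_reg_neq // h3 //; lia.
apply: triple_loop => //; first by lia.
  by move=> j _; rewrite /f set_reg_neq //; lia.
move=> j jN; set s1 := set_reg (f j) _ _.
have ev : eval s1 (Op Add (Var K) e) = \sum_(i < j.+1) g i.
  rewrite big_ord_recr [RHS]/= -(he j (\sum_(i < j) g i) jN) [LHS]/=.
  congr (_ + _); rewrite [LHS](_ : _ = reg s1 K) // /s1 set_reg_neq; last by lia.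
  exact: set_reg_eq.
have := @triple_assign K.+2 K (Op Add (Var K) e) s1 hW (leqW (leqnSn K)).
rewrite ev [below _ _]/= be ltnW ?ltnSn // => /(_ isT) h.
apply: triple_conseq (h _) _ _ _ => //.
- apply: leq_trans hS; rewrite -!(big_mkord xpredT g).
  by rewrite [leqRHS](big_cat_nat _ jN) //= leq_addr.
- by rewrite /=; lia.
- move=> s2 ag; apply: agrees_weaken ag _ _ _ _ => //; first by lia.
  move=> x xK; rewrite /s1 /f.
  have [->|nx] := eqVneq x K.
    by rewrite set_reg_eq [RHS]set_reg_neq ?set_reg_eq //; lia.
  have [->|nx'] := eqVneq x K.+1.
    by rewrite set_reg_neq ?set_reg_eq //; lia.
  by rewrite !set_reg_neq.
Qed.

Definition fill (K : nat) (base e : expr) : program :=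
  loop K 0 (store K.+1 (Op Add base (Var K)) e).

(** [e] is evaluated when the first [j] cells are already written, so an entry may depend on earlier
    ones; the quotients are computed that way. *)
Lemma triple_fill K base e s b N g :
  N <= B -> 0 < K -> reg s 0 = N ->
  B ^ (esize base).+1 <= W -> B ^ esize e <= W ->
  below K.+1 base -> below K.+1 e ->
  (forall m j, eval (set_reg (State (reg s) m) K j) base = b) ->
  (forall j, j < N ->
     eval (set_reg (State (reg s) (upd (mem s) b j g)) K j) e = g j) ->
  (forall j, j < N -> g j <= B) ->
  triple (agrees K predT s) (fill K base e) (N * (cost base + cost e + 8) + 3)
    (agrees K predT (State (reg s) (upd (mem s) b N g))).
Proof.
move=> hN K0 r0 hWb hWe bb be hb he hg.
have BW : B <= W.
  by apply: leq_trans _ hWb; rewrite -{1}(expn1 B) leq_exp2l.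
pose f j := State (reg s) (upd (mem s) b j g).
have := @triple_loop K 0 predT (store K.+1 (Op Add base (Var K)) e)
  (cost base + cost e + 4) f N hN BW K0 (fun _ _ => r0).
move=> h; apply: (triple_conseq (h _)).
- move=> j jN; set s1 := set_reg (f j) K j.
  have hWa : B ^ esize (Op Add base (Var K)) <= W by rewrite /= addn1.
  have := @triple_store K.+1 (Op Add base (Var K)) e s1 hWa hWe.
  rewrite [below _ (Op _ _ _)]/= bb ltnSn => /(_ isT be).
  rewrite he // => /(_ (hg _ jN)) h1.
  apply: triple_conseq h1 _ _ _ => //; first by rewrite /=; lia.
  move=> s2 ag; apply: agrees_weaken ag _ _ _ _ => //.
  by move=> x _; rewrite -[RHS](upd_step (mem s) b j g) /= eqxx /s1 hb.
- move=> s1 ag; apply: agrees_weaken ag _ _ _ _ => // x _ /=.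
  by rewrite upd_skip //; lia.
- by lia.
- by [].
Qed.

Definition fillsum (K : nat) (base e : expr) : program :=
  loop K 0 (Seq (sum K.+1 0 e) (store K.+2 (Op Add base (Var K)) (Var K.+1))).

Lemma triple_fillsum K base e s b N (h : nat -> nat -> nat) (g : nat -> nat) :
  N <= B -> 0 < K -> reg s 0 = N ->
  B ^ (esize base).+1 <= W -> B ^ (esize e).+1 <= W ->
  below K.+2 base -> below K.+3 e ->
  (forall m j x, eval (set_reg (set_reg (State (reg s) m) K j) K.+1 x) base = b) ->
  (forall j u x, j < N -> u < N ->
     eval (set_reg (set_reg (set_reg
       (State (reg s) (upd (mem s) b j g)) K j) K.+1 x) K.+2 u) e = h j u) ->
  (forall j, g j = \sum_(u < N) h j u) ->
  (forall j, j < N -> g j <= B) ->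
  triple (agrees K predT s) (fillsum K base e)
    (N * (N * (cost e + 7) + cost base + 14) + 3)
    (agrees K predT (State (reg s) (upd (mem s) b N g))).
Proof.
move=> hN K0 r0 hWb hWe bb be hb he hgE hg.
have BW : B <= W.
  by apply: leq_trans _ hWb; rewrite -{1}(expn1 B) leq_exp2l.
pose f j := State (reg s) (upd (mem s) b j g).
have := @triple_loop K 0 predT
  (Seq (sum K.+1 0 e) (store K.+2 (Op Add base (Var K)) (Var K.+1)))
  (N * (cost e + 7) + 4 + (cost base + 6)) f N hN BW K0 (fun _ _ => r0).
move=> hl; apply: (triple_conseq (hl _)).
- move=> j jN; set s1 := set_reg (f j) K j.
  have rs1 : reg s1 0 = N by rewrite /s1 set_reg_neq //; lia.
  have := @triple_sum K.+1 0 e s1 N (h j) hN hWe isT be rs1.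
  rewrite -hgE => /(_ (fun u x => he j u x jN) (hg _ jN)) h1.
  apply: triple_seq h1 _; set s2 := set_reg s1 _ _.
  have hWa : B ^ esize (Op Add base (Var K)) <= W by rewrite /= addn1.
  have hWv : B ^ esize (Var K.+1) <= W by rewrite expn1.
  have := @triple_store K.+2 (Op Add base (Var K)) (Var K.+1) s2 hWa hWv.
  rewrite [below _ (Op _ _ _)]/= bb ltnW ?ltnSn // => /(_ isT (ltnSn _)).
  rewrite [eval s2 (Var _)]set_reg_eq => /(_ (hg _ jN)) h2.
  have e2 : eval s2 (Op Add base (Var K)) = b + j.
    rewrite /s2 /s1 /f [eval _ _]/= hb.
    by rewrite eqn_leq ltnn andbF eqxx.
  rewrite e2 in h2.
  apply: triple_conseq h2 _ _ _ => //; first by rewrite /=; lia.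
  move=> s3 ag; apply: agrees_weaken ag _ _ _ _ => //.
    move=> x xK; have nK : x != K.+1 by lia.
    exact: (set_reg_neq s1 (g j) nK).
  by move=> x _; rewrite -[RHS](upd_step (mem s) b j g).
- move=> s1 ag; apply: agrees_weaken ag _ _ _ _ => // x _ /=.
  by rewrite upd_skip //; lia.
- by lia.
- by [].
Qed.

End Triples.

(** * Testing one code *)

(** The two lowest base-[n] digits of [c] name two vertices, meant to be the ends of the edge; for
    an adjacency matrix [g] this counts the walks of length 1 from [v] to them. *)
Definition seed (n : nat) (g : nat -> nat -> nat) (c v : nat) : nat :=
  g v (c %% n) + g v (c %/ n %% n).

(** The matrix [g] applied to the vector [D]; applied to walk counts, it lengthens the walks by
    one. *)
Definition nbsum (n : nat) (g : nat -> nat -> nat) (D : nat -> nat) (v : nat) :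
    nat :=
  \sum_(u < n) g v u * D u.

(* The number [q] is read in mixed radix, with the three digits
   [digit0 v <= D' v], [digit1 v <= D v] and [digit2 v <= D v] at each [v]. *)
Section Decode.

Variables (D D' : nat -> nat) (q : nat).

Fixpoint quot (v : nat) : nat :=
  if v is v'.+1 then quot v' %/ ((1 + D' v') * (1 + D v') * (1 + D v'))
  else q.

Definition digit0 v := quot v %% (1 + D' v).
Definition digit1 v := quot v %/ (1 + D' v) %% (1 + D v).
Definition digit2 v := quot v %/ (1 + D' v) %/ (1 + D v) %% (1 + D v).

End Decode.

(* For nonnegative integer vectors s and t with sums a and b over neighbours,
   the defects vanish exactly when s and t are the indicator functions of
   independent sets with the same closed neighbourhood. *)
Definition defect (s a t b : nat) : nat :=
  s * (s + a - 1) + t * (t + b - 1) +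
  ((1 - (s + a)) * (t + b) + (1 - (t + b)) * (s + a)).

Section Pair.

Variables (n : nat) (g : nat -> nat -> nat) (c : nat).

Definition walks1 := seed n g c.
Definition walks3 := nbsum n g (nbsum n g walks1).
Definition code := c %/ n %/ n.
(** [digit0] is meant for the common part of the pair, the other two digits for the differences.
    Overlaps give entries above 1, which the defect detects. *)
Definition fstset v :=
  digit0 walks1 walks3 code v + digit1 walks1 walks3 code v.
Definition sndset v :=
  digit0 walks1 walks3 code v + digit2 walks1 walks3 code v.
Definition badness :=
  \sum_(v < n) defect (fstset v) (nbsum n g fstset v)
                      (sndset v) (nbsum n g sndset v).

End Pair.

Local Notation "a +' b" := (Op Add a b) (at level 50, left associativity).
Local Notation "a -' b" := (Op Sub a b) (at level 50, left associativity).
Local Notation "a *' b" := (Op Mul a b) (at level 40, left associativity).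
Local Notation "a /' b" := (Op Div a b) (at level 40, left associativity).

(* Registers: 0 holds n, 1 the output address, 2 the number of codes and 3 the
   current code.  Between the adjacency matrix and the output lie the arrays
   [arr i]: 0, 1, 2 count walks of length 1, 2, 3; 3 and 4 are the two sets, 5
   and 6 their sums over neighbours; 7, with n + 1 cells, holds [quot]. *)
Definition Mod (a b : expr) : expr := a -' a /' b *' b.
Definition nV := Var 0.
Definition cell (v u : expr) : expr := Fetch (v *' nV +' u).
Definition arr (i : nat) : expr := nV *' nV +' Cst i *' nV.
Definition get (i : nat) (v : expr) : expr := Fetch (arr i +' v).

Definition fill_seed : program :=
  fill 4 (arr 0) (cell (Var 4) (Mod (Var 3) nV) +'
                  cell (Var 4) (Mod (Var 3 /' nV) nV)).

Definition fill_nbsum (src dst : nat) : program :=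
  fillsum 4 (arr dst) (cell (Var 4) (Var 6) *' get src (Var 6)).

(** The recursion computes quotient [v.+1] from quotient [v], so the first cell is stored separately
    and the filled array is shifted by one. *)
Definition fill_quot : program :=
  Seq (store 4 (arr 7) (Var 3 /' nV /' nV))
    (fill 4 (arr 7 +' Cst 1)
      (get 7 (Var 4) /' ((Cst 1 +' get 2 (Var 4)) *' (Cst 1 +' get 0 (Var 4))
                           *' (Cst 1 +' get 0 (Var 4))))).

Definition rad' := Cst 1 +' get 2 (Var 4).
Definition rad := Cst 1 +' get 0 (Var 4).

Definition fill_fst : program :=
  fill 4 (arr 3) (Mod (get 7 (Var 4)) rad' +' Mod (get 7 (Var 4) /' rad') rad).

Definition fill_snd : program :=
  fill 4 (arr 4) (Mod (get 7 (Var 4)) rad' +'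
                  Mod (get 7 (Var 4) /' rad' /' rad) rad).

Definition Defect (s a t b : expr) : expr :=
  s *' (s +' a -' Cst 1) +' t *' (t +' b -' Cst 1) +'
  ((Cst 1 -' (s +' a)) *' (t +' b) +' (Cst 1 -' (t +' b)) *' (s +' a)).

Definition sum_badness : program :=
  sum 4 0 (Defect (get 3 (Var 5)) (get 5 (Var 5)) (get 4 (Var 5)) (get 6 (Var 5))).

Definition row : expr := Var 1 +' (Var 3 +' Var 3) *' nV.

(** The factor [1 - badness] is 1 for a valid code and 0 otherwise. Invalid codes thus yield the
    trivial equation, and each code has its row at a fixed address. *)
Definition write_fst : program :=
  fill 5 row (get 3 (Var 5) *' (Cst 1 -' Var 4)).
Definition write_snd : program :=
  fill 5 (row +' nV) (get 4 (Var 5) *' (Cst 1 -' Var 4)).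

Definition body : program :=
  Seq fill_seed (Seq (fill_nbsum 0 1) (Seq (fill_nbsum 1 2)
  (Seq fill_quot (Seq fill_fst (Seq fill_snd
  (Seq (fill_nbsum 3 5) (Seq (fill_nbsum 4 6)
  (Seq sum_badness (Seq write_fst write_snd))))))))).

Lemma leq_sum_const n (f : nat -> nat) b :
  (forall u, u < n -> f u <= b) -> \sum_(u < n) f u <= n * b.
Proof.
move=> h; rewrite -[n in leqRHS]card_ord -sum_nat_const.
by apply: leq_sum => u _; apply: h.
Qed.

Lemma sub_modn a b : a - a %/ b * b = a %% b.
Proof. by rewrite {1}(divn_eq a b) addKn. Qed.

Lemma cell_lt n v u : v < n -> u < n -> v * n + u < n * n.
Proof. nia. Qed.

Lemma leq_square n : n <= n * n.
Proof. nia. Qed.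

(** * Correctness and running time of one iteration *)

Section Body.

Variables W B n c : nat.
Hypothesis B_gt1 : 1 < B.
Hypothesis BW : B ^ 400 <= W.
Hypothesis n_gt0 : 0 < n.
Hypothesis cB : c <= B.
Hypothesis nB : 80 * n ^ 6 <= B.

Variables (r m : nat -> nat).
Hypothesis r0 : r 0 = n.
Hypothesis r1 : r 1 = n * n + 9 * n.
Hypothesis r3 : r 3 = c.

Variable g : nat -> nat -> nat.
Hypothesis gm : forall v u, v < n -> u < n -> m (v * n + u) = g v u.
Hypothesis g1 : forall v u, v < n -> u < n -> g v u <= 1.

Local Notation D1 := (walks1 n g c).
Local Notation D2 := (nbsum n g D1).
Local Notation D3 := (walks3 n g c).
Local Notation Q := (quot D1 D3 (code n c)).
Local Notation S := (fstset n g c).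
Local Notation T := (sndset n g c).

Lemma D1_le v : v < n -> D1 v <= 2.
Proof. by move=> vn; rewrite -[2]/(1 + 1) leq_add // g1 // ltn_pmod. Qed.

Lemma nbsum_le D b v :
  (forall u, u < n -> D u <= b) -> v < n -> nbsum n g D v <= n * b.
Proof.
move=> h vn; apply: (leq_sum_const (f := fun u => g v u * D u)) => u un.
by rewrite -[leqRHS]mul1n leq_mul // ?g1 // h.
Qed.

Lemma D2_le v : v < n -> D2 v <= n * 2.
Proof. by apply: nbsum_le => u; exact: D1_le. Qed.

Lemma D3_le v : v < n -> D3 v <= n * (n * 2).
Proof. by apply: nbsum_le => u; exact: D2_le. Qed.

Lemma Q_le v : Q v <= c.
Proof.
elim: v => [|v ih] /=; first by rewrite /code !(leq_trans (leq_div _ _)).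
exact: leq_trans (leq_div _ _) ih.
Qed.

(** A digit is less than its radix even if the code describes no local pair, so the bounds on [D1]
    and [D3] suffice for every [c]. *)
Lemma ST_le v : v < n -> S v <= 4 * n ^ 2 /\ T v <= 4 * n ^ 2.
Proof.
move=> vn; have h1 := D1_le vn; have h3 := D3_le vn.
have h2 : n * (n * 2) = 2 * n ^ 2 by rewrite mulnA mulnC.
have n2 : 0 < n ^ 2 by rewrite expn_gt0 n_gt0.
have p0 : digit0 D1 D3 (code n c) v <= D3 v by rewrite -ltnS ltn_pmod.
have p1 : digit1 D1 D3 (code n c) v <= D1 v by rewrite -ltnS ltn_pmod.
have p2 : digit2 D1 D3 (code n c) v <= D1 v by rewrite -ltnS ltn_pmod.
by rewrite /fstset /sndset; lia.
Qed.

Lemma nb_le v : v < n ->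
  nbsum n g S v <= n * (4 * n ^ 2) /\ nbsum n g T v <= n * (4 * n ^ 2).
Proof. by split; apply: nbsum_le => // u un; case: (ST_le un). Qed.

(** The two quadratic terms are at most [32 * n ^ 5] each and the two others at most [8 * n ^ 3]
    each; hence the constant 80. *)
Lemma defect_le v : v < n ->
  defect (S v) (nbsum n g S v) (T v) (nbsum n g T v) <= 80 * n ^ 5.
Proof.
move=> vn; have [hS hT] := ST_le vn; have [ha hb] := nb_le vn.
have e3 : n * (4 * n ^ 2) = 4 * n ^ 3 by rewrite mulnCA -expnS.
rewrite e3 in ha hb.
have h23 : n ^ 2 <= n ^ 3 by rewrite leq_pexp2l.
have h35 : n ^ 3 <= n ^ 5 by rewrite leq_pexp2l.
have e5 : n ^ 5 = n ^ 2 * n ^ 3 by rewrite -expnD.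
have p1 : S v * (S v + nbsum n g S v - 1) <= (4 * n ^ 2) * (8 * n ^ 3).
  by apply: leq_mul => //; lia.
have p2 : T v * (T v + nbsum n g T v - 1) <= (4 * n ^ 2) * (8 * n ^ 3).
  by apply: leq_mul => //; lia.
have p3 : (1 - (S v + nbsum n g S v)) * (T v + nbsum n g T v) <= 1 * (8 * n ^ 3).
  by apply: leq_mul; lia.
have p4 : (1 - (T v + nbsum n g T v)) * (S v + nbsum n g S v) <= 1 * (8 * n ^ 3).
  by apply: leq_mul; lia.
rewrite /defect; lia.
Qed.

Lemma badness_le : badness n g c <= B.
Proof.
apply: leq_trans nB; rewrite expnS mulnCA.
exact: (leq_sum_const (f := fun v => defect (S v) _ (T v) _) defect_le).
Qed.

Lemma le_B x b : x <= b * n ^ 6 -> b <= 80 -> x <= B.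
Proof.
by move=> h1 h2; apply: leq_trans h1 (leq_trans _ nB); rewrite leq_mul2r h2 orbT.
Qed.

(** 400 is a bound for the sizes of all expressions evaluated in [body]. *)
Lemma size_W k : k <= 400 -> B ^ k <= W.
Proof. by move=> h; apply: leq_trans BW; rewrite leq_exp2l. Qed.

(** [sc k] is the value of [arr k]; [m1] to [m8] are the memories after the successive arrays have
    been filled. *)
Let sc k := n * n + k * n.
Let m1 := upd m (sc 0) n D1.
Let m2 := upd m1 (sc 1) n D2.
Let m3 := upd m2 (sc 2) n D3.
Let m4 := upd m3 (sc 7) n.+1 Q.
Let m5 := upd m4 (sc 3) n S.
Let m6 := upd m5 (sc 4) n T.
Let m7 := upd m6 (sc 5) n (nbsum n g S).
Let m8 := upd m7 (sc 6) n (nbsum n g T).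

Lemma pow6 : n * n <= n ^ 6 /\ n <= n ^ 6 /\ n ^ 3 <= n ^ 6.
Proof.
by rewrite mulnn -{3}(expn1 n) !leq_pexp2l.
Qed.

Lemma seed_spec :
  triple W (agrees B 4 predT (State r m)) fill_seed (100 * (n * n))
    (agrees B 4 predT (State r m1)).
Proof.
have [h2 [h1 _]] := pow6.
apply: triple_time.
  apply: (@triple_fill W B B_gt1 4 _ _ (State r m) (sc 0) n D1) => //.
  - by apply: (@le_B _ 1); lia.
  - exact: size_W.
  - exact: size_W.
  - by move=> m' j; rewrite /= r0.
  - move=> j jn /=; rewrite r0 r3 !sub_modn /D1 /seed.
    have a1 := cell_lt jn (ltn_pmod c n_gt0).
    have a2 := cell_lt jn (ltn_pmod (c %/ n) n_gt0).
    rewrite !upd_skip; try by rewrite /sc; lia.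
    by rewrite !gm ?ltn_pmod.
  - by move=> j jn; apply: (@le_B _ 2) => //; have := D1_le jn; lia.
rewrite /=; have := leq_square n; lia.
Qed.



Lemma sc_disjoint i j : i < j -> sc i + n <= sc j.
Proof. by move=> ij; rewrite /sc -addnA leq_add2l addnC -mulSn leq_mul2r ij orbT. Qed.

(** Source and target must be different arrays, since the source is still read while the target is
    being written. *)
Lemma nbsum_spec m' src dst D :
  src < 7 -> dst < 7 -> src != dst ->
  (forall v u, v < n -> u < n -> m' (v * n + u) = g v u) ->
  (forall u, u < n -> m' (sc src + u) = D u) ->
  (forall v, v < n -> nbsum n g D v <= B) ->
  triple W (agrees B 4 predT (State r m')) (fill_nbsum src dst) (100 * (n * n))
    (agrees B 4 predT (State r (upd m' (sc dst) n (nbsum n g D)))).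
Proof.
move=> hsrc hdst sd hg hD hB.
have [h2 [h1 _]] := pow6.
apply: triple_time.
  apply: (@triple_fillsum W B B_gt1 4 _ _ (State r m') (sc dst) n
            (fun v u => g v u * D u) (nbsum n g D)) => //.
  - by apply: (@le_B _ 1); lia.
  - by apply: size_W; rewrite /=; lia.
  - by apply: size_W; rewrite /=; lia.
  - by move=> m'' j x; rewrite /= r0.
  - move=> j u x jn un /=; rewrite r0 -(hg _ _ jn un) -(hD _ un).
    have := cell_lt jn un.
    have : sc src + n <= sc dst \/ sc dst + n <= sc src.
      by case: (ltngtP src dst) sd => // /sc_disjoint; [left | right].
    move=> d cl; rewrite !upd_skip //; move: d; rewrite /sc; lia.
rewrite /=; have := leq_square n; lia.
Qed.

Lemma quot_spec :
  triple W (agrees B 4 predT (State r m3)) fill_quot (200 * (n * n))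
    (agrees B 4 predT (State r m4)).
Proof.
have [h2 [h1 _]] := pow6.
have cQ : code n c <= B by apply: leq_trans cB; exact: (Q_le 0).
apply: triple_time.
  apply: triple_seq.
    apply: triple_store => //; try exact: size_W.
    by rewrite /= r3 r0.
  rewrite [set_mem _ _ _](_ : _ = State r [eta m3 with sc 7 |-> code n c]); last first.
    by rewrite /set_mem /= r3 r0.
  (* The cell at [sc 7] and the [n] cells behind it together form the array of [n.+1] quotients in
     [m4]. *)
  apply: (@triple_conseq _ _ _ _ (agrees B 4 predT (State r
      (upd [eta m3 with sc 7 |-> code n c] (sc 7 + 1) n (fun j => Q j.+1)))));
    last 1 first.
  - move=> s' ag; apply: agrees_weaken ag _ _ _ _ => // x _; rewrite /= /m4 /upd /=.
    case: (eqVneq x (sc 7)) => [->|nx].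
      by rewrite leqnn subnn ifN ?ifT //; lia.
    case: ifP => hx.
      rewrite ifT; last by lia.
      by have -> : x - sc 7 = (x - (sc 7 + 1)).+1 by lia.
    by rewrite ifN //; lia.
  apply: (@triple_fill W B B_gt1 4 _ _
    (State r [eta m3 with sc 7 |-> code n c]) (sc 7 + 1) n (fun j => Q j.+1)) => //.
  - by apply: (@le_B _ 1); lia.
  - exact: size_W.
  - exact: size_W.
  - by move=> m' j; rewrite /= r0.
  - move=> j jn /=; rewrite r0 -/(sc 7) -/(sc 2) -/(sc 0).
    set M := upd _ _ _ _.
    have -> : M (sc 7 + j) = Q j.
      case: j jn @M => [|j] jn; rewrite /= ?addn0.
        by rewrite upd_skip /= ?eqxx //; lia.
      by have -> : sc 7 + j.+1 = sc 7 + 1 + j; [lia | rewrite upd_get].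
    have -> : M (sc 2 + j) = D3 j.
      rewrite /M upd_skip /=; last by rewrite /sc; lia.
      rewrite ifN; last by rewrite /sc; lia.
      by rewrite /m3 upd_get.
    have -> // : M (sc 0 + j) = D1 j.
    rewrite /M upd_skip /=; last by rewrite /sc; lia.
    rewrite ifN; last by rewrite /sc; lia.
    rewrite /m3 upd_skip; last by rewrite /sc; lia.
    rewrite /m2 upd_skip; last by rewrite /sc; lia.
    by rewrite /m1 upd_get.
  - by move=> j _; apply: leq_trans cB; exact: (Q_le j.+1).
  - by [].
  - exact: leqnn.
rewrite /=; have := leq_square n; lia.
Qed.

Lemma fst_spec :
  triple W (agrees B 4 predT (State r m4)) fill_fst (500 * (n * n))
    (agrees B 4 predT (State r m5)).
Proof.
have [h2 [h1 _]] := pow6.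
apply: triple_time.
  apply: (@triple_fill W B B_gt1 4 _ _ (State r m4) (sc 3) n S) => //.
  - by apply: (@le_B _ 1); lia.
  - exact: size_W.
  - exact: size_W.
  - by move=> m' j; rewrite /= r0.
  - move=> j jn /=; rewrite r0 -/(sc 7) -/(sc 2) -/(sc 0) !sub_modn.
    set M := upd _ _ _ _.
    have -> : M (sc 7 + j) = Q j.
      rewrite /M upd_skip; last by rewrite /sc; lia.
      by rewrite /m4 upd_get // ltnW.
    have -> : M (sc 2 + j) = D3 j.
      rewrite /M upd_skip; last by rewrite /sc; lia.
      rewrite /m4 upd_skip; last by rewrite /sc; lia.
      by rewrite /m3 upd_get.
    have -> // : M (sc 0 + j) = D1 j.
    rewrite /M upd_skip; last by rewrite /sc; lia.
    rewrite /m4 upd_skip; last by rewrite /sc; lia.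
    rewrite /m3 upd_skip; last by rewrite /sc; lia.
    rewrite /m2 upd_skip; last by rewrite /sc; lia.
    by rewrite /m1 upd_get.
  - move=> j /ST_le[h _]; apply: (@le_B _ 4) => //.
    by have := leq_pexp2l n_gt0 (isT : 2 <= 6); lia.
rewrite /=; have := leq_square n; lia.
Qed.

Lemma snd_spec :
  triple W (agrees B 4 predT (State r m5)) fill_snd (500 * (n * n))
    (agrees B 4 predT (State r m6)).
Proof.
have [h2 [h1 _]] := pow6.
apply: triple_time.
  apply: (@triple_fill W B B_gt1 4 _ _ (State r m5) (sc 4) n T) => //.
  - by apply: (@le_B _ 1); lia.
  - exact: size_W.
  - exact: size_W.
  - by move=> m' j; rewrite /= r0.
  - move=> j jn /=; rewrite r0 -/(sc 7) -/(sc 2) -/(sc 0) !sub_modn.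
    set M := upd _ _ _ _.
    have -> : M (sc 7 + j) = Q j.
      rewrite /M upd_skip; last by rewrite /sc; lia.
      rewrite /m5 upd_skip; last by rewrite /sc; lia.
      by rewrite /m4 upd_get // ltnW.
    have -> : M (sc 2 + j) = D3 j.
      rewrite /M upd_skip; last by rewrite /sc; lia.
      rewrite /m5 upd_skip; last by rewrite /sc; lia.
      rewrite /m4 upd_skip; last by rewrite /sc; lia.
      by rewrite /m3 upd_get.
    have -> // : M (sc 0 + j) = D1 j.
    rewrite /M upd_skip; last by rewrite /sc; lia.
    rewrite /m5 upd_skip; last by rewrite /sc; lia.
    rewrite /m4 upd_skip; last by rewrite /sc; lia.
    rewrite /m3 upd_skip; last by rewrite /sc; lia.
    rewrite /m2 upd_skip; last by rewrite /sc; lia.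
    by rewrite /m1 upd_get.
  - move=> j /ST_le[_ h]; apply: (@le_B _ 4) => //.
    by have := leq_pexp2l n_gt0 (isT : 2 <= 6); lia.
rewrite /=; have := leq_square n; lia.
Qed.

Lemma m8_get j : j < n ->
  [/\ m8 (sc 3 + j) = S j, m8 (sc 4 + j) = T j,
      m8 (sc 5 + j) = nbsum n g S j & m8 (sc 6 + j) = nbsum n g T j].
Proof.
move=> jn; split; rewrite /m8; last by rewrite upd_get.
- rewrite upd_skip; last by rewrite /sc; lia.
  rewrite /m7 upd_skip; last by rewrite /sc; lia.
  rewrite /m6 upd_skip; last by rewrite /sc; lia.
  by rewrite /m5 upd_get.
- rewrite upd_skip; last by rewrite /sc; lia.
  rewrite /m7 upd_skip; last by rewrite /sc; lia.
  by rewrite /m6 upd_get.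
- rewrite upd_skip; last by rewrite /sc; lia.
  by rewrite /m7 upd_get.
Qed.

Local Notation bad := (badness n g c).

Lemma badness_spec :
  triple W (agrees B 4 predT (State r m8)) sum_badness (300 * (n * n))
    (agrees B 5 predT (set_reg (State r m8) 4 bad)).
Proof.
have [h2 [h1 _]] := pow6.
apply: triple_time.
  apply: (@triple_sum W B B_gt1 4 0 _ (State r m8) n (fun v =>
    defect (S v) (nbsum n g S v) (T v) (nbsum n g T v))) => //.
  - by apply: (@le_B _ 1); lia.
  - exact: size_W.
  - move=> j x /m8_get[h3 h4 h5 h6] /=.
    by rewrite r0 -/(sc 3) -/(sc 4) -/(sc 5) -/(sc 6) h3 h4 h5 h6.
  - exact: badness_le.
rewrite /=; have := leq_square n; lia.
Qed.

Let ro := n * n + 9 * n + (c + c) * n.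
Let r' := reg (set_reg (State r m8) 4 bad).
Let m9 := upd m8 ro n (fun v => S v * (1 - bad)).
Let m10 := upd m9 (ro + n) n (fun v => T v * (1 - bad)).

Lemma write_fst_spec :
  triple W (agrees B 5 predT (State r' m8)) write_fst (100 * (n * n))
    (agrees B 5 predT (State r' m9)).
Proof.
have [h2 [h1 _]] := pow6.
apply: triple_time.
  apply: (@triple_fill W B B_gt1 5 _ _ (State r' m8) ro n
    (fun v => S v * (1 - bad))) => //.
  - by apply: (@le_B _ 1); lia.
  - exact: size_W.
  - exact: size_W.
  - by move=> m' j; rewrite /r' /= r0 r1 r3.
  - move=> j jn /=; have [h _ _ _] := m8_get jn.
    rewrite /r' /= r0 -/(sc 3) upd_skip; last by rewrite /sc /ro; lia.
    by rewrite h.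
  - move=> j /ST_le[h _]; apply: (@le_B _ 4) => //.
    apply: leq_trans (leq_mul h (leq_subr _ _)) _.
    by have := leq_pexp2l n_gt0 (isT : 2 <= 6); lia.
rewrite /=; have := leq_square n; lia.
Qed.

Lemma write_snd_spec :
  triple W (agrees B 5 predT (State r' m9)) write_snd (100 * (n * n))
    (agrees B 5 predT (State r' m10)).
Proof.
have [h2 [h1 _]] := pow6.
apply: triple_time.
  apply: (@triple_fill W B B_gt1 5 _ _ (State r' m9) (ro + n) n
    (fun v => T v * (1 - bad))) => //.
  - by apply: (@le_B _ 1); lia.
  - exact: size_W.
  - exact: size_W.
  - by move=> m' j; rewrite /r' /= r0 r1 r3.
  - move=> j jn /=; have [_ h _ _] := m8_get jn.
    rewrite /r' /= r0 -/(sc 4) upd_skip; last by rewrite /sc /ro; lia.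
    by rewrite /m9 upd_skip ?h //; rewrite /sc /ro; lia.
  - move=> j /ST_le[_ h]; apply: (@le_B _ 4) => //.
    apply: leq_trans (leq_mul h (leq_subr _ _)) _.
    by have := leq_pexp2l n_gt0 (isT : 2 <= 6); lia.
rewrite /=; have := leq_square n; lia.
Qed.

(** The scratch arrays lie between the matrix and the output and are dead between iterations. The
    last one starts at [n * n + 7 * n] and has [n.+1] cells, so it ends in time because [n] is
    positive. *)
Let live x := (x < n * n) || (n * n + 9 * n <= x).

Lemma body_spec :
  triple W (agrees B 4 predT (State r m)) body (3000 * (n * n))
    (agrees B 4 live (State r
       (upd (upd m ro n (fun v => S v * (1 - bad)))
         (ro + n) n (fun v => T v * (1 - bad))))).
Proof.
have [h2 [h1 h3]] := pow6.
have cl := @cell_lt n.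
have main : triple W (agrees B 4 predT (State r m)) body
  (100 * (n * n) + (100 * (n * n) + (100 * (n * n) + (200 * (n * n) +
  (500 * (n * n) + (500 * (n * n) + (100 * (n * n) + (100 * (n * n) +
  (300 * (n * n) + (100 * (n * n) + 100 * (n * n)))))))))))
  (agrees B 5 predT (State r' m10)).
  apply: triple_seq seed_spec _.
  apply: triple_seq (nbsum_spec (src := 0) (D := D1) _ _ _ _ _ _) _ => //.
  - move=> v u vn un; have := cl _ _ vn un => c1.
    by rewrite /m1 upd_skip ?gm //; rewrite /sc; lia.
  - by move=> u un; rewrite /m1 upd_get.
  - by move=> v vn; apply: (@le_B _ 2) => //; have := D2_le vn; lia.
  apply: triple_seq (nbsum_spec (src := 1) (D := D2) _ _ _ _ _ _) _ => //.
  - move=> v u vn un; have := cl _ _ vn un => c1.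
    by rewrite /m2 /m1 !upd_skip ?gm //; rewrite /sc; lia.
  - by move=> u un; rewrite /m2 upd_get.
  - by move=> v vn; apply: (@le_B _ 2) => //; apply: leq_trans (D3_le vn) _; lia.
  apply: triple_seq quot_spec _.
  apply: triple_seq fst_spec _.
  apply: triple_seq snd_spec _.
  have gm6 v u : v < n -> u < n -> m6 (v * n + u) = g v u.
    move=> vn un; have := cl _ _ vn un => c1.
    rewrite /m6 /m5 /m4 /m3 /m2 /m1 !upd_skip ?gm //; rewrite /sc; lia.
  have e3 : n * (4 * n ^ 2) = 4 * n ^ 3 by rewrite mulnCA -expnS.
  apply: triple_seq (nbsum_spec (src := 3) (D := S) _ _ _ _ _ _) _ => //.
  - move=> u un; rewrite /m6 upd_skip; last by rewrite /sc; lia.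
    by rewrite /m5 upd_get.
  - by move=> v vn; apply: (@le_B _ 4) => //; have [] := nb_le vn; lia.
  apply: triple_seq (nbsum_spec (src := 4) (D := T) _ _ _ _ _ _) _ => //.
  - move=> v u vn un; rewrite /m7 upd_skip ?gm6 //.
    by have := cl _ _ vn un; rewrite /sc; lia.
  - move=> u un; rewrite /m7 upd_skip; last by rewrite /sc; lia.
    by rewrite /m6 upd_get.
  - by move=> v vn; apply: (@le_B _ 4) => //; have [] := nb_le vn; lia.
  apply: triple_seq badness_spec _.
  by apply: triple_seq write_fst_spec write_snd_spec.
apply: (triple_conseq main) => //; first by lia.
move=> s ag; apply: agrees_weaken ag _ _ _ _ => //.
  by do 4!case=> //.
move=> x /= lx; rewrite /m10 /m9 /upd; case: ifP => // _; case: ifP => // _.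
rewrite /m8 /m7 /m6 /m5 /m4 /m3 /m2 /m1 !upd_skip //; move: lx; rewrite /live /sc; lia.
Qed.

End Body.

(** * The loop over all codes *)

Fixpoint power (e : nat) : expr :=
  if e is e'.+1 then Op Mul (power e') nV else Cst 1.

Definition count (A e : nat) : expr := Op Mul (Cst A) (power e).
Definition out : expr := Op Add (Op Mul nV nV) (Op Mul (Cst 9) nV).

(** Register 0 must hold [n] during the loop, so it receives the number of equations only at the
    end. *)
Definition main (A e : nat) : program :=
  Seq (compile 1 2 out) (Seq (compile 2 3 (count A e))
    (Seq (loop 3 2 body) (compile 0 4 (Var 2)))).

Lemma powerE e :
  [/\ forall s, eval s (power e) = reg s 0 ^ e, esize (power e) = e + 2,
      cost (power e) = 3 * e + 1 & forall K, 0 < K -> below K (power e)].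
Proof.
elim: e => [|e [h1 h2 h3 h4]]; first by split=> // s.
split=> [s|||K K0] /=; rewrite ?h1 ?h2 ?h3 ?h4 ?K0 ?expnSr //; lia.
Qed.

Section Main.

Variables (n : nat) (g : nat -> nat -> nat) (adjm : nat -> nat).

Definition rowpos (c : nat) : nat := n * n + 9 * n + (c + c) * n.

(** The loop invariant: the memory after [c] codes, with the scratch arrays ignored. *)
Fixpoint outmem (c : nat) : nat -> nat :=
  if c is c'.+1 then
    upd (upd (outmem c') (rowpos c') n
           (fun v => fstset n g c' v * (1 - badness n g c')))
      (rowpos c' + n) n (fun v => sndset n g c' v * (1 - badness n g c'))
  else adjm.

Lemma outmem_adj c x : x < n * n -> outmem c x = adjm x.
Proof.
by elim: c => //= c ih xn; rewrite !upd_skip ?ih //; rewrite /rowpos; lia.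
Qed.

Lemma outmem_row c M v : c < M -> v < n ->
  outmem M (rowpos c + v) = fstset n g c v * (1 - badness n g c) /\
  outmem M (rowpos c + n + v) = sndset n g c v * (1 - badness n g c).
Proof.
move=> cM vn; elim: M cM => //= M ih; rewrite ltnS leq_eqVlt => /orP[/eqP->|cM].
  split; last by rewrite upd_get.
  rewrite upd_skip; last by lia.
  by rewrite upd_get.
have [h1 h2] := ih cM.
have : (c + c + 2) * n <= (M + M) * n by rewrite leq_mul2r; apply/orP; right; lia.
rewrite mulnDl => hr.
by rewrite !upd_skip // /rowpos; lia.
Qed.

End Main.

Lemma adj_cell_out n (G : sgraph 'I_n) a : adj_cell G a <= 1.
Proof. by rewrite /adj_cell; case: [exists _, _]. Qed.

(** [B] dominates both the number [M] of codes and the bound [80 * n ^ 6] needed in the body. The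
    summand [A + e] in the exponent pays for the expression [count A e], where the constant [A] adds
    [A.+1] to the size. *)
Lemma main_run A e n (G : sgraph 'I_n) W g
  (M := A * n ^ e) (B := 80 * A * n ^ (e + 6)) :
  0 < A -> 0 < n ->
  (forall v u, v < n -> u < n -> adj_cell G (v * n + u) = g v u) ->
  B ^ (400 + A + e) <= W ->
  exists t s, [/\ exec W (main A e) (input_state G) t s,
    t <= (3100 + 3 * e) * A * n ^ (e + 2),
    reg s 0 = M, reg s 1 = n * n + 9 * n &
    forall c v, c < M -> v < n ->
      mem s (rowpos n c + v) = fstset n g c v * (1 - badness n g c) /\
      mem s (rowpos n c + n + v) = sndset n g c v * (1 - badness n g c)].
Proof.
move=> A0 n0 hg hW.
have pe : 0 < n ^ e by rewrite expn_gt0 n0.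
have p6 : 0 < n ^ 6 by rewrite expn_gt0 n0.
have h26 : n * n <= n ^ 6 by rewrite mulnn leq_pexp2l.
have h16 : n <= n ^ 6 by rewrite -{1}(expn1 n) leq_pexp2l.
have B80 : 80 * n ^ 6 <= B.
  by rewrite /B expnD -mulnA leq_mul2l /= mulnA leq_pmull // muln_gt0 A0 pe.
have MB : M <= B.
  rewrite /B /M expnD -mulnA; apply: leq_trans (leq_pmull _ (isT : 0 < 80)).
  by rewrite leq_mul2l leq_pmulr ?orbT.
have B1 : 1 < B by lia.
have W1 k : k <= 400 + A + e -> B ^ k <= W.
  by move=> h; apply: leq_trans hW; rewrite leq_exp2l.
have BW : B <= W by rewrite -(expn1 B); apply: W1; lia.
have g1 v u : v < n -> u < n -> g v u <= 1.
  by move=> vn un; rewrite -hg // adj_cell_out.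
set o := n * n + 9 * n; set s0 := input_state G.
pose s1 := set_reg s0 1 o; pose s2 := set_reg s1 2 M.
have [pE pS pC pB] := powerE e.
pose f c := State (reg s2) (outmem n g (adj_cell G) c).
pose live x := (x < n * n) || (o <= x).
have t1 : triple W (agrees B 1 predT s0) (compile 1 2 out) (cost out)
    (agrees B 2 predT s1).
  by apply: triple_assign => //; rewrite /= ?W1 //; lia.
have t2 : triple W (agrees B 2 predT s1) (compile 2 3 (count A e)) (3 * e + 3)
    (agrees B 3 predT s2).
  have ev : eval s1 (count A e) = M by rewrite /= pE.
  rewrite /s2 -ev.
  apply: (triple_time (triple_assign (K := 2) (r := 2) B1 _ _ _ _)) => //.
  - by apply: W1; rewrite /= pS; lia.
  - by rewrite /= pB.
  - by rewrite ev.
  - by rewrite /= pC; lia.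
have r1 : reg s2 1 = o by [].
have t3 : triple W (agrees B 3 live (f 0)) (loop 3 2 body)
    (M * (3000 * (n * n) + 4) + 3) (agrees B 3 live (f M)).
  apply: triple_loop => // c cM; apply: triple_havoc => m hm.
  have hm' x : live x -> m x = outmem n g (adj_cell G) c x by exact: hm.
  have gm v u : v < n -> u < n -> m (v * n + u) = g v u.
    move=> vn un; have h := cell_lt vn un.
    by rewrite hm' ?outmem_adj ?hg // /live h.
  have hW4 : B ^ 400 <= W by apply: W1; lia.
  have cB : c <= B by apply: leq_trans MB; apply: ltnW.
  apply: triple_conseq (body_spec (r := reg (set_reg (f c) 3 c)) (m := m)
    B1 hW4 n0 cB B80 _ r1 _ gm g1) _ _ _ => // s ag.
  apply: agrees_weaken ag _ _ _ _ => // x hx.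
  rewrite /= /upd -/(rowpos n c); case: ifP => // _; case: ifP => // _.
  exact: hm'.
have t34 : triple W (agrees B 3 predT s2)
    (Seq (loop 3 2 body) (compile 0 4 (Var 2))) (M * (3000 * (n * n) + 4) + 3 + 2)
    (agrees B 3 live (set_reg (f M) 0 M)).
  apply: (triple_seq (A' := agrees B 3 live (f M))).
    by apply: triple_conseq t3 _ _ _ => // s ag; apply: agrees_weaken ag _ _ _ _.
  apply: triple_havoc => m hm.
  have := triple_assign (K := 3) (r := 0) (e := Var 2) (s := State (reg (f M)) m) B1.
  move=> /(_ W _ isT isT MB) h; apply: triple_conseq (h _) _ _ _ => //.
  by move=> s ag; apply: agrees_weaken ag _ _ _ _ => // x; apply: hm.
have [|t [s [hx ht [hr hm _ _]]]] := triple_seq t1 (triple_seq t2 t34) (s := s0).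
  split=> //; first by case=> //= _; lia.
  by move=> x; apply: leq_trans (adj_cell_out G x) (ltnW B1).
exists t, s; split=> //.
- apply: leq_trans ht _.
  have -> : (3100 + 3 * e) * A * n ^ (e + 2) = (3100 + 3 * e) * (M * (n * n)).
    by rewrite expnD /M -mulnn !mulnA.
  have M0 : 0 < M by rewrite muln_gt0 A0.
  have c1 : cost out = 10 by [].
  have n1 : 0 < n * n by rewrite muln_gt0 n0.
  have p1 : 1 <= M * (n * n) by rewrite muln_gt0 M0.
  have p2 : M <= M * (n * n) by rewrite leq_pmulr.
  rewrite c1 mulnDr mulnCA mulnDl.
  have p3 : 3 * e <= 3 * e * (M * (n * n)) by rewrite leq_pmulr.
  lia.
- by rewrite hr.
- by rewrite hr.
- move=> c v cM vn; have [h1 h2] := outmem_row g (adj_cell G) cM vn.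
  by rewrite !hm ?h1 ?h2 //; rewrite /live /rowpos /o; lia.
Qed.

(** * Exchanging maximal independent sets *)

Section Exchange.

Variables (V : finType) (G : sgraph V).
Implicit Types S T I : {set V}.

(** Membership in the closed neighbourhood of [S]. *)
Definition dominated S v := (v \in S) || [exists u in S, G v u].

Lemma independentP S :
  reflect {in S &, forall u v, ~~ G u v} (independent G S).
Proof.
apply: (iffP forall_inP) => [h u v uS vS | h u uS].
  by have /forall_inP/(_ v vS) := h u uS.
by apply/forall_inP => v vS; apply: h.
Qed.

Lemma independentS S T : S \subset T -> independent G T -> independent G S.
Proof.
by move=> /subsetP ST /independentP h; apply/independentP => u v /ST uT /ST vT; apply: h.
Qed.

Lemma max_independentP S :
  reflect (independent G S /\ forall v, dominated S v) (max_independent G S).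
Proof.
apply: (iffP maxsetP) => -[iS hS]; split=> //.
- move=> v; apply/negPn/negP; rewrite negb_or => /andP[vS /exists_inP nS].
  have iU : independent G (v |: S).
    apply/independentP => a b; rewrite !inE.
    move=> /predU1P[->|aS] /predU1P[->|bS]; rewrite ?adj_irr //.
    + by apply/negP => h; apply: nS; exists b.
    + by apply/negP => h; apply: nS; exists a; rewrite // adj_sym.
    + exact: (independentP _ iS).
  by case/negP: vS; rewrite -(hS _ iU (subsetUr _ _)) setU11.
- move=> T iT ST; apply/eqP; rewrite eqEsubset ST andbT.
  apply/subsetP => v vT; have /orP[//|/exists_inP[u uS vu]] := hS v.
  by case/negP: (independentP _ iT v u vT (subsetP ST u uS)).
Qed.

Lemma max_independent_ext S :
  independent G S -> exists2 M, max_independent G M & S \subset M.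
Proof. by move=> iS; have [M mM SM] := maxset_exists iS; exists M. Qed.

Variables (R : realType) (w : {ffun V -> R}).

Local Open Scope ring_scope.

Lemma weight_setID S T : weight w S = weight w (S :&: T) + weight w (S :\: T).
Proof. exact: big_setID. Qed.

(** Extend [S] to a maximal independent set [M]. No vertex of [M :\: S] is dominated by [S], hence
    none by [T], so [T :|: M :\: S] is maximal independent too; cancel the weight of [M :\: S]. *)
Lemma WCW_exchange S T :
  w \in WCW G R -> independent G S -> independent G T ->
  dominated S =1 dominated T -> weight w S = weight w T.
Proof.
move=> /forallP wP iS iT dST.
have [M mM SM] := max_independent_ext iS.
have /max_independentP[iM dM] := mM.
have nJ v : v \in M :\: S -> ~~ dominated T v.
  rewrite inE -dST negb_or => /andP[-> vM] /=.
  by apply/exists_inP => -[u /(subsetP SM) uM]; apply/negP/(independentP _ iM).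
have mN : max_independent G (T :|: M :\: S).
  apply/max_independentP; split.
    have nadj t v : t \in T -> v \in M :\: S -> ~~ G v t.
      move=> tT /nJ; rewrite negb_or => /andP[_ /exists_inP h].
      by apply/negP => tv; apply: h; exists t.
    apply/independentP => a b /setUP[aT|aJ] /setUP[bT|bJ].
    - exact: (independentP _ iT).
    - by rewrite adj_sym nadj.
    - exact: nadj.
    - by case/setDP: aJ bJ => aM _ /setDP[bM _]; apply: (independentP _ iM).
  move=> v; have [vT|] := boolP (dominated T v).
    case/orP: vT => [vT|/exists_inP[u uT vu]]; apply/orP.
      by left; rewrite inE vT.
    by right; apply/exists_inP; exists u; rewrite // inE uT.
  (* A vertex not dominated by [S] is dominated by [M], hence by [M :\: S]. *)
  rewrite -dST => nS; have := dM v; apply: contraLR.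
  rewrite !negb_or !inE => /andP[/norP[_ nD]].
  move: nS; rewrite negb_or => /andP[nvS /exists_inP nSv] /exists_inP nN.
  rewrite nvS /= in nD; rewrite nD; apply/exists_inP => -[u uM vu].
  have [uS|uS] := boolP (u \in S); first by apply: nSv; exists u.
  by apply: nN; exists u; rewrite // !inE uS uM orbT.
have /forallP/(_ (T :|: M :\: S)) := wP M.
rewrite mM mN /= => /eqP; rewrite (weight_setID M S).
rewrite (weight_setID (T :|: M :\: S) T).
have -> : M :&: S = S by apply/setIidPr.
have -> : (T :|: M :\: S) :&: T = T by apply/setIidPr/subsetUl.
have -> : (T :|: M :\: S) :\: T = M :\: S.
  apply/setP => v; rewrite !inE; have [vT|//] := boolP (v \in T) => /=.
  by apply/esym/negbTE/negP => vJ; move: (nJ v); rewrite inE vJ negb_or vT => /(_ isT).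
exact: GRing.addIr.
Qed.

(* A maximal independent set containing [S :&: T], [s] and [t] has larger
   intersections with both [S] and [T] than these have with each other. *)
Lemma WCW_joined :
  (forall S T, max_independent G S -> max_independent G T ->
     (forall s t, s \in S :\: T -> t \in T :\: S -> G s t) ->
     weight w S = weight w T) ->
  w \in WCW G R.
Proof.
move=> h; apply/forallP => S; apply/forallP => T.
apply/implyP => mS; apply/implyP => mT; apply/eqP.
have [m hm] := ubnP (#|V| - #|S :&: T|)%N.
elim: m S T mS mT hm => // m ih S T mS mT; rewrite ltnS => hm.
have [/forallP hj|/forallPn[[s t]]] :=
    boolP [forall p : V * V, (p.1 \in S :\: T) ==> (p.2 \in T :\: S) ==> G p.1 p.2].
  by apply: h => // s t sS tT; have := hj (s, t); rewrite /= sS tT.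
rewrite /= !negb_imply => /and3P[/setDP[sS sT] /setDP[tT tS] nst].
have [iS _] := max_independentP _ mS; have [iT _] := max_independentP _ mT.
have [|M mM /subsetP UM] := @max_independent_ext ([set s; t] :|: S :&: T).
  have nts : ~~ G t s by rewrite adj_sym.
  apply/independentP => a b; rewrite !inE => /orP[/orP[]/eqP->|/andP[aS aT]]
    /orP[/orP[]/eqP->|/andP[bS bT]]; rewrite ?adj_irr //;
    by [apply: (independentP _ iS) | apply: (independentP _ iT)].
have sM : s \in M by apply: UM; rewrite !inE eqxx.
have tM : t \in M by apply: UM; rewrite !inE eqxx orbT.
have IM v : v \in S -> v \in T -> v \in M.
  by move=> vS vT; apply: UM; rewrite !inE vS vT orbT.
have closer (A : {set V}) :
    S :&: T \proper A -> (#|V| - #|A| < m)%N.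
  move=> /proper_card ltA; apply: leq_trans hm; apply: ltn_sub2l => //.
  exact: leq_trans ltA (max_card _).
transitivity (weight w M); apply: ih => //; apply: closer; apply/properP; split.
- by apply/subsetP => v; rewrite !inE => /andP[vS vT]; rewrite vS IM.
- by exists s; rewrite !inE ?sS ?sM // (negbTE sT) andbF.
- by apply/subsetP => v; rewrite !inE => /andP[vS vT]; rewrite vT IM.
- by exists t; rewrite !inE ?tT ?tM // (negbTE tS).
Qed.

End Exchange.

(** With [A] one of the differences of [S] and [T], this is [S] or [T] with its common vertices
    outside [L] removed. *)
Definition localize (V : finType) (S T L A : {set V}) : {set V} :=
  S :&: T :&: L :|: A.

Lemma localize_independent (V : finType) (G : sgraph V) (S T L : {set V}) :
  max_independent G S -> max_independent G T ->
  independent G (localize S T L (S :\: T)) /\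
  independent G (localize S T L (T :\: S)).
Proof.
move=> mS mT.
have [iS _] := max_independentP _ _ mS; have [iT _] := max_independentP _ _ mT.
split; [apply: independentS iS | apply: independentS iT];
  by apply/subsetP => v; rewrite !inE; do 2!case: (_ \in _).
Qed.

(** The critical case is a neighbour [v] of some [u] in [S :\: T]. If [v] is not in [T], some [t] in
    [T] is adjacent to it; if [t] is also in [S], the walk from [u] over [v] to [t] puts [t] into
    [L], so [t] is kept. *)
Lemma localize_sub_dominated (V : finType) (G : sgraph V) (S T L : {set V}) y0 v :
  max_independent G S -> max_independent G T ->
  (forall s t, s \in S :\: T -> t \in T :\: S -> G s t) ->
  y0 \in T :\: S ->
  (forall x z u, x \in S :\: T -> G x z -> G z u -> u \in L) ->
  dominated G (localize S T L (S :\: T)) v ->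
  dominated G (localize S T L (T :\: S)) v.
Proof.
move=> mS mT joined y0T hL.
have [iS dS] := max_independentP _ _ mS; have [iT dT] := max_independentP _ _ mT.
case/orP => [/setUP[vI|vX]|/exists_inP[u /setUP[uI|uX] vu]]; apply/orP.
- by left; rewrite inE vI.
- by right; apply/exists_inP; exists y0; [rewrite inE y0T orbT | exact: joined].
- by right; apply/exists_inP; exists u; rewrite // inE uI.
have /setDP[uS uT] := uX.
have vS : v \notin S by apply/negP => vS; case/negP: (independentP _ _ iS v u vS uS).
case/orP: (dT v) => [vT|/exists_inP[t tT vt]]; first by left; rewrite !inE vT vS orbT.
right; apply/exists_inP; exists t => //.
rewrite !inE tT; have [tS|//] := boolP (t \in S).
by rewrite (hL u v) // adj_sym.
Qed.

(** * Codes of local pairs *)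

Lemma mixed_radix (r d : nat -> nat) n :
  (forall v, v < n -> d v < r v) ->
  exists2 q, q < \prod_(v < n) r v &
    forall v, v < n -> q %/ (\prod_(u < v) r u) %% r v = d v.
Proof.
elim: n => [|n ih] hd; first by exists 0; rewrite ?big_ord0.
have [v vn|q hq hv] := ih; first by apply: hd; rewrite ltnW.
have dn := hd n (ltnSn n); set P := \prod_(v < n) r v in hq *.
exists (d n * P + q).
  by rewrite big_ord_recr /= -/P; nia.
move=> v; rewrite ltnS leq_eqVlt => /predU1P[->|vn].
  by rewrite divnMDl -/P ?(leq_ltn_trans _ hq) // divn_small // addn0 modn_small.
have Pv : \prod_(u < v) r u > 0.
  apply/prodn_gt0 => u; apply: leq_ltn_trans (hd u _) => //.
  by rewrite ltnS ltnW // (ltn_trans _ vn).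
(* Splitting the product at [v] shows that the new top digit adds a multiple of [r v] to the
   quotient, which leaves digit [v] unchanged. *)
have -> : P = \prod_(v.+1 <= u < n) r u * r v * \prod_(u < v) r u.
  rewrite /P -!(big_mkord xpredT r) (@big_cat_nat _ _ _ v.+1) //= big_nat_recr //=.
  lia.
by rewrite mulnA divnMDl // mulnA modnMDl hv.
Qed.

Lemma quotE D D' q v :
  quot D D' q v = q %/ \prod_(u < v) ((1 + D' u) * (1 + D u) * (1 + D u)).
Proof.
elim: v => [|v ih]; first by rewrite big_ord0 divn1.
by rewrite big_ord_recr divnMA -ih.
Qed.

(** The three digits at [v] are packed into one digit of the product radix. Since [1 + k <= 2 ^ k],
    the product of all radices is at most 2 to the sum of the digit bounds. *)
Lemma encode D D' (i x y : nat -> nat) n :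
  (forall v, v < n -> [/\ i v <= D' v, x v <= D v & y v <= D v]) ->
  exists2 q, q < 2 ^ (\sum_(v < n) D' v + 2 * \sum_(v < n) D v) &
    forall v, v < n -> [/\ digit0 D D' q v = i v, digit1 D D' q v = x v
                         & digit2 D D' q v = y v].
Proof.
move=> h.
have [v vn|q hq hv] := @mixed_radix (fun v => (1 + D' v) * (1 + D v) * (1 + D v))
  (fun v => i v + (1 + D' v) * (x v + (1 + D v) * y v)) n.
  by have [] := h v vn; nia.
exists q.
  apply: leq_trans hq _.
  rewrite big_distrr -big_split /= expn_sum leq_prod // => v _.
  rewrite mul2n -addnn !expnD mulnA.
  have e k : 1 + k <= 2 ^ k by apply: ltn_expl.
  by rewrite !leq_mul.
move=> v vn; have [hi hx hy] := h v vn.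
rewrite /digit0 /digit1 /digit2 quotE.
set z := q %/ _; have {hv} := hv v vn; rewrite -/z => hz.
set R' := 1 + D' v in hz *; set R := 1 + D v in hz *.
have -> : z = ((z %/ (R' * R * R) * R + y v) * R + x v) * R' + i v.
  by rewrite {1}(divn_eq z (R' * R * R)) hz; lia.
have e a b c : b < c -> (a * c + b) %% c = b /\ (a * c + b) %/ c = a.
  move=> bc; rewrite modnMDl modn_small // divnMDl ?(leq_ltn_trans _ bc) //.
  by rewrite divn_small // addn0.
have [-> ->] := e ((z %/ (R' * R * R) * R + y v) * R + x v) (i v) R' hi.
have [-> ->] := e (z %/ (R' * R * R) * R + y v) (x v) R hx.
by have [-> _] := e (z %/ (R' * R * R)) (y v) R hy.
Qed.

(** [s * (s + a - 1)] vanishes iff [s] is 0, or [s] is 1 and [a] is 0. By truncation [1 - (s + a)]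
    is nonzero only if [s + a] is 0, so the mixed terms compare the two supports. *)
Lemma defect_eq0 s a t b :
  (defect s a t b == 0) =
  [&& s <= 1, t <= 1, (0 < s) ==> (a == 0), (0 < t) ==> (b == 0)
    & (0 < s + a) == (0 < t + b)].
Proof.
rewrite /defect.
case: s => [|[|s]]; case: t => [|[|t]]; case: a => [|a]; case: b => [|b];
  rewrite ?addn0 ?add0n ?mul0n ?mul1n //=; lia.
Qed.

(** * Graph notions expressed by the adjacency matrix *)

Section Numeric.

Variables (n : nat) (G : sgraph 'I_n).

Definition adjn (v u : nat) : nat := adj_cell G (v * n + u).

Lemma adjnE (i j : 'I_n) : adjn i j = G i j.
Proof.
rewrite /adjn /adj_cell; congr nat_of_bool.
apply/existsP/idP => [[i' /existsP[j' /andP[/eqP e Gij]]]|Gij].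
  have n0 : 0 < n := leq_ltn_trans (leq0n j') (ltn_ord j').
  have ei : i = i'.
    apply/val_inj; move: (congr1 (divn^~ n) e).
    by rewrite /= !divnMDl // !divn_small // !addn0.
  have ej : j = j'.
    apply/val_inj; move: (congr1 (modn^~ n) e).
    by rewrite /= !modnMDl !modn_small.
  by rewrite ei ej.
by exists i; apply/existsP; exists j; rewrite eqxx.
Qed.

Lemma sum_adjn_le (u : 'I_n) : \sum_(v < n) adjn v u <= max_degree G.
Proof.
apply: leq_trans (leq_bigmax u); rewrite /neighbors -sum1dep_card [leqRHS]big_mkcond /=.
by apply: leq_sum => v _; rewrite adjnE adj_sym; case: (G u v).
Qed.

(** Exchanging the sums leaves column sums of the adjacency matrix, which by symmetry are
    degrees. *)
Lemma sum_nbsum_le D :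
  \sum_(v < n) nbsum n adjn D v <= max_degree G * \sum_(v < n) D v.
Proof.
rewrite /nbsum exchange_big big_distrr; apply: leq_sum => u _ /=.
by rewrite -big_distrl leq_mul2r sum_adjn_le orbT.
Qed.

Variables (f : nat -> nat) (A : {set 'I_n}).
Hypothesis fA : forall v : 'I_n, f v = (v \in A).

Lemma dominatedE (v : 'I_n) : dominated G A v = (0 < f v + nbsum n adjn f v).
Proof.
rewrite addn_gt0 fA lt0b; congr (_ || _); apply/exists_inP/idP => [[u uA vu]|].
  by rewrite /nbsum (bigD1 u) //= adjnE fA uA vu.
rewrite lt0n sum_nat_eq0 => /forallPn[u]; rewrite /= adjnE fA muln_eq0 negb_or.
by rewrite !eqb0 !negbK => /andP[vu uA]; exists u.
Qed.

Lemma independentE :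
  independent G A = [forall v : 'I_n, (0 < f v) ==> (nbsum n adjn f v == 0)].
Proof.
apply: eq_forallb => v; rewrite fA lt0b; congr (_ ==> _).
rewrite sum_nat_eq0; apply: eq_forallb => u.
by rewrite adjnE fA muln_eq0 !eqb0 implybE orbC.
Qed.

End Numeric.

(** * Soundness and completeness of the equations *)

Section Rows.

Variables (n : nat) (G : sgraph 'I_n) (R : realType) (w : {ffun 'I_n -> R}).

Local Notation g := (adjn G).
Local Notation Delta := (max_degree G).

Local Open Scope ring_scope.

Definition weight_row (f : nat -> nat) : R := \sum_(j < n) (f j)%:R * w j.

Lemma weight_rowE (f : nat -> nat) (A : {set 'I_n}) :
  (forall v : 'I_n, f v = (v \in A)) -> weight_row f = weight w A.
Proof.
move=> fA; rewrite /weight_row /weight [RHS]big_mkcond /=.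
by apply: eq_bigr => v _; rewrite fA; case: (v \in A); rewrite ?GRing.mul1r ?GRing.mul0r.
Qed.

(** With all defects zero, both vectors are indicators of independent sets with the same closed
    neighbourhood, so [WCW_exchange] applies. *)
Lemma row_sound c :
  w \in WCW G R -> badness n g c = 0%N ->
  weight_row (fstset n g c) = weight_row (sndset n g c).
Proof.
move=> wG /eqP; rewrite sum_nat_eq0 => /forallP /= bad0.
set f := fstset n g c in bad0 *; set h := sndset n g c in bad0 *.
have le1 (k : nat) : (k <= 1)%N -> k = (0 < k)%N by case: k => [|[]].
have fA (v : 'I_n) : f v = (v \in [set v : 'I_n | (0 < f v)%N]).
  by rewrite inE; apply: le1; have := bad0 v; rewrite defect_eq0 => /and5P[].
have hB (v : 'I_n) : h v = (v \in [set v : 'I_n | (0 < h v)%N]).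
  by rewrite inE; apply: le1; have := bad0 v; rewrite defect_eq0 => /and5P[].
rewrite (weight_rowE fA) (weight_rowE hB).
apply: (WCW_exchange wG).
- rewrite (independentE G fA); apply/forallP => v.
  by have := bad0 v; rewrite defect_eq0 => /and5P[].
- rewrite (independentE G hB); apply/forallP => v.
  by have := bad0 v; rewrite defect_eq0 => /and5P[].
- move=> v; rewrite (dominatedE G fA) (dominatedE G hB).
  by have := bad0 v; rewrite defect_eq0 => /and5P[_ _ _ _ /eqP].
Qed.

Definition indic (A : {set 'I_n}) (v : nat) : nat :=
  if insub v is Some i then i \in A else 0%N.

Lemma indicE A (v : 'I_n) : indic A v = (v \in A).
Proof. by rewrite /indic valK. Qed.

(** Joinedness makes [y0] adjacent to all of [S :\: T] and [x0] to all of [T :\: S]. Hence [D1] is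
    positive on both differences, and [D3] at every vertex reached from them by two more edges. *)
Lemma local_row M (S T : {set 'I_n}) (x0 y0 : 'I_n) :
  max_independent G S -> max_independent G T ->
  (forall s t, s \in S :\: T -> t \in T :\: S -> G s t) ->
  x0 \in S :\: T -> y0 \in T :\: S ->
  (n * n * 2 ^ (2 * Delta ^ 3 + 4 * Delta) <= M)%N ->
  exists (L : {set 'I_n}) (c : nat),
    [/\ (c < M)%N, badness n g c = 0%N,
        forall v : 'I_n, fstset n g c v = (v \in localize S T L (S :\: T))
      & forall v : 'I_n, sndset n g c v = (v \in localize S T L (T :\: S))].
Proof.
move=> mS mT joined xX yY hM.
pose D1 v := (g v x0 + g v y0)%N; pose D3 := nbsum n g (nbsum n g D1).
pose L := [set v : 'I_n | (0 < D3 v)%N]; pose I := S :&: T :&: L.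
have n0 : (0 < n)%N := leq_ltn_trans (leq0n x0) (ltn_ord x0).
have D1X v : v \in S :\: T -> (0 < D1 v)%N.
  by move=> vX; rewrite /D1 !adjnE (joined v y0) // addn1.
have D1Y v : v \in T :\: S -> (0 < D1 v)%N.
  by move=> vY; rewrite /D1 !adjnE adj_sym (joined x0 v).
have nbgt (D : nat -> nat) (a b : 'I_n) : G a b -> (0 < D b)%N -> (0 < nbsum n g D a)%N.
  by move=> ab Db; rewrite /nbsum (bigD1 b) //= adjnE ab mul1n addn_gt0 Db.
have hL (x z u : 'I_n) : (0 < D1 x)%N -> G x z -> G z u -> u \in L.
  move=> Dx xz zu; rewrite inE; apply: (nbgt _ u z); first by rewrite adj_sym.
  by apply: (nbgt _ z x) => //; rewrite adj_sym.
have [|q hq hdig] := @encode D1 D3 (indic I) (indic (S :\: T)) (indic (T :\: S)) n.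
  move=> v vn; rewrite -[v]/(nat_of_ord (Ordinal vn)); set i := Ordinal vn.
  rewrite !indicE; split.
  - by case: (boolP (i \in I)) => //; rewrite inE => /andP[_]; rewrite inE.
  - by case: (boolP (i \in _)) => // /D1X.
  - by case: (boolP (i \in _)) => // /D1Y.
(* In base [n] the lowest digits are [x0] and [y0]; the rest is the mixed-radix number. *)
pose c := (x0 + n * (y0 + n * q))%N.
have cx : (c %% n = x0)%N by rewrite /c addnC mulnC modnMDl modn_small.
have cy : (c %/ n = y0 + n * q)%N.
  by rewrite /c addnC mulnC divnMDl // divn_small // addn0.
have cy' : (c %/ n %% n = y0)%N.
  by rewrite cy addnC mulnC modnMDl modn_small.
have cq : code n c = q.
  by rewrite /code cy addnC mulnC divnMDl // divn_small // addn0.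
have w1 : walks1 n g c = D1 by rewrite /walks1 /seed cx cy'.
have w3 : walks3 n g c = D3 by rewrite /walks3 w1.
have fE (v : 'I_n) : fstset n g c v = (v \in localize S T L (S :\: T)).
  rewrite /fstset w1 w3 cq; have [-> -> _] := hdig v (ltn_ord v).
  rewrite !indicE !inE.
  by case: (v \in S); case: (v \in T); case: (0 < D3 v)%N.
have sE (v : 'I_n) : sndset n g c v = (v \in localize S T L (T :\: S)).
  rewrite /sndset w1 w3 cq; have [-> _ ->] := hdig v (ltn_ord v).
  rewrite !indicE !inE.
  by case: (v \in S); case: (v \in T); case: (0 < D3 v)%N.
exists L, c; split=> //.
(* Each further walk step multiplies the total by at most [Delta]; as [D1] bounds two digits, the
   exponent is [2 * Delta ^ 3 + 2 * (2 * Delta)]. *)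
- have d1 : (\sum_(v < n) D1 v <= 2 * Delta)%N.
    by rewrite big_split /= mul2n -addnn leq_add // sum_adjn_le.
  have d3 : (\sum_(v < n) D3 v <= 2 * Delta ^ 3)%N.
    apply: leq_trans (sum_nbsum_le G _) _.
    rewrite (_ : 2 * Delta ^ 3 = Delta * (Delta * (2 * Delta)))%N; last by lia.
    rewrite leq_mul2l; apply/orP; right.
    apply: leq_trans (sum_nbsum_le G _) _.
    by rewrite leq_mul2l d1 orbT.
  have {}hq : (q < 2 ^ (2 * Delta ^ 3 + 4 * Delta))%N.
    by apply: leq_trans hq _; rewrite leq_exp2l //; lia.
  apply: leq_trans hM; rewrite /c.
  have := ltn_ord x0; have := ltn_ord y0.
  set E := (2 ^ _)%N in hq *; move=> hy hx.
  have h1 : (y0 + n * q < n * E)%N by nia.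
  by rewrite -mulnA; nia.
- apply/eqP; rewrite sum_nat_eq0; apply/forallP => v /=; rewrite defect_eq0.
  have [iX iY] := localize_independent L mS mT.
  rewrite (independentE G fE) in iX; rewrite (independentE G sE) in iY.
  rewrite (forallP iX v) (forallP iY v) -(dominatedE G fE) -(dominatedE G sE).
  rewrite fE sE !leq_b1 /=; apply/eqP; apply/idP/idP.
  - apply: (localize_sub_dominated (y0 := y0)) => // x z u xX'; apply: hL; exact: D1X.
  - rewrite /localize [S :&: T]setIC.
    apply: (localize_sub_dominated (y0 := x0)) => //.
      by move=> s t sY tX; rewrite adj_sym joined.
    by move=> x z u xY'; apply: hL; apply: D1Y.
Qed.

Lemma rows_complete M :
  (n * n * 2 ^ (2 * Delta ^ 3 + 4 * Delta) <= M)%N ->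
  (forall c, (c < M)%N -> badness n g c = 0%N ->
     weight_row (fstset n g c) = weight_row (sndset n g c)) ->
  w \in WCW G R.
Proof.
move=> hM h; apply: WCW_joined => S T mS mT joined.
have eqST (A B : {set 'I_n}) :
    max_independent G A -> max_independent G B -> A :\: B = set0 -> A = B.
  move=> mA mB /eqP; rewrite setD_eq0 => AB.
  by have [_ /(_ B)->] := maxsetP mA; have [iB _] := maxsetP mB.
(* An empty difference forces [S = T] by maximality; otherwise both differences supply the ends of
   the edge. *)
have [/eqST->//|[x0 x0X]] := set_0Vmem (S :\: T).
have [/eqST->//|[y0 y0Y]] := set_0Vmem (T :\: S).
have [L [c [cM bad0 fE sE]]] := local_row mS mT joined x0X y0Y hM.
have := h c cM bad0; rewrite (weight_rowE fE) (weight_rowE sE).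
have wU (A : {set 'I_n}) : [disjoint S :&: T :&: L & A] ->
    weight w (localize S T L A) = weight w (S :&: T :&: L) + weight w A.
  by move=> dA; rewrite /weight -bigU //=; apply: eq_bigl => v; rewrite inE.
rewrite !wU; last 2 first.
- rewrite disjoint_subset; apply/subsetP => v.
  by rewrite !inE; case: (v \in S); case: (v \in T).
- rewrite disjoint_subset; apply/subsetP => v.
  by rewrite !inE; case: (v \in S); case: (v \in T).
(* Cancelling the common local part leaves equal weights of the two differences; adding the weight
   of all of [S :&: T] gives the claim. *)
move=> /GRing.addrI e; rewrite (weight_setID w S T) (weight_setID w T S).
by rewrite e [T :&: S]setIC.
Qed.

End Rows.

(** * The algorithm *)

Import Order.TTheory GRing.Theory Num.Theory.
Local Open Scope ring_scope.

(** Cubing the degree bound gives [D ^ 3 <= k ^ 3 * log2 n], which is then exponentiated. *)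
Lemma exp2_cube_le (R : realType) (k n D : nat) :
  (0 < n)%N -> D%:R <= k%:R * (log2 n%:R) `^ 3^-1 :> R ->
  (2 ^ (D ^ 3) <= n ^ (k ^ 3))%N.
Proof.
move=> n0 hD; have l2 : 0 < ln 2 :> R by rewrite ln_gt0 // ltr1n.
have ln0 : 0 <= ln n%:R :> R by rewrite ln_ge0 // ler1n.
have L0 : 0 <= log2 n%:R :> R by rewrite /log2 divr_ge0 // ltW.
have cube : (log2 n%:R `^ 3^-1) ^+ 3 = log2 n%:R :> R.
  by rewrite -powR_mulrn ?powR_ge0 // -powRrM mulVf ?powRr1 // pnatr_eq0.
have h3 : D%:R ^+ 3 <= k%:R ^+ 3 * log2 n%:R :> R.
  by rewrite -cube -exprMn lerXn2r // nnegrE ?mulr_ge0 ?powR_ge0 ?ler0n.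
rewrite -(ler_nat R) !natrX -ler_ln ?posrE ?exprn_gt0 ?ltr0n //.
rewrite !lnXn ?ltr0n // -[ln 2 *+ _]mulr_natl -[ln n%:R *+ _]mulr_natl.
by rewrite !natrX -ler_pdivlMr // -mulrA.
Qed.

Lemma exp2_4_le k n D :
  (0 < k)%N -> (0 < n)%N -> (2 ^ (D ^ 3) <= n ^ (k ^ 3))%N ->
  (2 ^ (4 * D) <= 2 ^ (16 * k ^ 3) * n)%N.
Proof.
move=> k0 n0 h; have p : (0 < 2 ^ (16 * k ^ 3))%N by rewrite expn_gt0.
have k3 : (0 < k ^ 3)%N by rewrite expn_gt0 k0.
(* Either the cube of D absorbs the linear term, or D is bounded in terms of k. *)
have [le|lt] := leqP (4 * k ^ 3) (D ^ 2).
  (* After raising to the power [k ^ 3], it remains that [4 * D * k ^ 3 <= D ^ 3]. *)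
  apply: leq_trans (leq_pmull _ p); rewrite -(leq_exp2r _ _ k3) -expnM.
  by apply: leq_trans h; rewrite leq_exp2l // expnS mulnAC mulnC leq_mul2l le orbT.
(* Here [4 * D <= 4 * D ^ 2 < 16 * k ^ 3], the origin of the constant. *)
apply: leq_trans (leq_pmulr _ n0); rewrite leq_exp2l //.
have : (D <= D ^ 2)%N by nia.
lia.
Qed.

Lemma output_rowsE (R : realType) n (s : state) (w : {ffun 'I_n -> R}) M
    (F H : nat -> nat -> nat) :
  reg s 0 = M -> reg s 1 = (n * n + 9 * n)%N ->
  (forall c v, (c < M)%N -> (v < n)%N ->
     mem s (rowpos n c + v) = F c v /\ mem s (rowpos n c + n + v) = H c v) ->
  reflect (forall c, (c < M)%N -> weight_row w (F c) = weight_row w (H c))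
    (w \in output_solutions R s).
Proof.
move=> r0 r1 hm.
have lhsE (i : 'I_(reg s 0)) : \sum_j (output_lhs n s i j)%:R * w j = weight_row w (F i).
  have iM : (i < M)%N by rewrite -r0.
  apply: eq_bigr => j _; rewrite mxE r1 -addnn; congr (_%:R * _).
  by have [<- _] := hm i j iM (ltn_ord j).
have rhsE (i : 'I_(reg s 0)) : \sum_j (output_rhs n s i j)%:R * w j = weight_row w (H i).
  have iM : (i < M)%N by rewrite -r0.
  apply: eq_bigr => j _; rewrite mxE r1 -addnn; congr (_%:R * _).
  have [_ <-] := hm i j iM (ltn_ord j); congr (mem s _).
  by rewrite /rowpos mulSn; lia.
apply: (iffP forallP) => [h c cM|h i].
  have cr : (c < reg s 0)%N by rewrite r0.
  by have /eqP := h (Ordinal cr); rewrite lhsE rhsE.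
by rewrite lhsE rhsE h // -r0.
Qed.

Theorem theorem9 (R : realType) (k : nat) (hk : (0 < k)%N) :
  exists (p : program) (C d : nat),
    forall (n : nat) (G : sgraph 'I_n),
      (0 < n)%N ->
      (max_degree G)%:R <= k%:R * (log2 n%:R) `^ 3^-1 :> R ->
      exists (t : nat) (s : state),
        [/\ exec (C * n ^ d)%N p (input_state G) t s,
            (t <= C * n ^ (3 + 2 * k ^ 2 + 2 * k ^ 3))%N
          & output_solutions R s =i WCW G R].
Proof.
(* [A * n ^ e] bounds the number of codes: [n ^ 2] for the edge, [n ^ (2 * k ^ 3)] for the cubic
   part of the exponent, and [A * n] for [2 ^ (4 * D)]. *)
pose A := (2 ^ (16 * k ^ 3))%N; pose e := (3 + 2 * k ^ 3)%N.
pose E := (400 + A + e)%N; pose K := ((3100 + 3 * e) * A)%N.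
have A0 : (0 < A)%N by rewrite expn_gt0.
(* One constant serves both bounds: [(80 * A) ^ E] for the word size and [K] for the time. *)
exists (main A e), ((80 * A) ^ E + K)%N, ((e + 6) * E)%N => n G n0 hD.
have [|t [s [hx ht r0 r1 hm]]] := @main_run A e n G
  (((80 * A) ^ E + K) * n ^ ((e + 6) * E)) (adjn G) A0 n0 (fun _ _ _ _ => erefl).
  by rewrite -/E expnMn -expnM leq_mul2r leq_addr orbT.
exists t, s; split=> //.
  apply: leq_trans ht _; rewrite -/K; apply: leq_mul; first exact: leq_addl.
  (* The time exponent is [e + 2 = 5 + 2 * k ^ 3], within the claim because [2 * k ^ 2 >= 2]. *)
  rewrite leq_pexp2l // /e; have : (k ^ 2 > 0)%N by rewrite expn_gt0 hk.
  lia.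
move=> w.
have row1 (f : nat -> nat) :
    weight_row w (fun v => f v * (1 - 0))%N = weight_row w f.
  by apply: eq_bigr => v _; rewrite muln1.
apply/(output_rowsE w r0 r1 hm)/idP => [h|wG c _].
  apply: (@rows_complete _ _ _ _ (A * n ^ e)) => [|c cM bad0].
    have h3 := exp2_cube_le n0 hD; have h4 := exp2_4_le hk n0 h3.
    have h5 : (2 ^ (2 * max_degree G ^ 3) <= n ^ (2 * k ^ 3))%N.
      by rewrite mulnC expnM [(2 * k ^ 3)%N]mulnC expnM leq_exp2r.
    apply: (@leq_trans (n * n * (n ^ (2 * k ^ 3) * (A * n)))).
      by rewrite (expnD 2 (2 * max_degree G ^ 3)) leq_mul2l leq_mul ?orbT.
    rewrite /e (expnD n 3) -[(n ^ 3)%N]/(n * (n * n))%N; lia.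
  by have := h c cM; rewrite bad0 !row1.
case: (posnP (badness n (adjn G) c)) => [bad0|].
  by rewrite bad0 !row1; apply: row_sound.
(* Positive badness makes the factor [1 - badness] zero, so both sides of the equation vanish. *)
rewrite -subn_eq0 => /eqP->; rewrite /weight_row.
by rewrite !big1 // => j _; rewrite muln0 mul0r.
Qed.
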